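(* Let $D\subset\mathbb{R}^2$ be a bounded simply connected domain with $C^1$ boundary and barycenter at the origin. Assume that $\chi_D$ is a V-state with angular velocity $\Omega=\frac12$, i.e. there is a constant $\mu\in\mathbb{R}$ with $$\psi(x)-\tfrac14|x|^2=\mu\quad\text{for all }x\in\partial D,\qquad \psi(x)=\frac1{2\pi}\int_D\log|x-y|\,dy .$$ Then $D$ is a disc.
   Context: A V-state (rotating patch) for the 2D incompressible Euler equations is a domain $D$ such that the vortex patch $\omega_0=\chi_D$ evolves as $\omega(t)=\chi_{D_t}$ with $D_t$ the rotation of $D$ about its barycenter (taken to be $0$) by angle $\Omega t$; for a $C^1$ boundary this is equivalent to the condition that $\psi(x)-\frac12\Omega|x|^2$ is constant on $\partial D$, where $\psi$ is the stream function of $\chi_D$ given in the claim. *)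

(* Defs.v *)
From HB Require Import structures.
From mathcomp Require Import all_boot all_order all_algebra.
From mathcomp Require Import all_classical all_reals all_analysis.
Set Implicit Arguments. Unset Strict Implicit. Unset Printing Implicit Defensive.
Import Order.TTheory GRing.Theory Num.Theory.
Import numFieldNormedType.Exports.
Local Open Scope classical_set_scope.
Local Open Scope ring_scope.

Section Plane.
Variable R : realType.
Notation P := (R * R)%type.

Definition psub (x y : P) : P := (x.1 - y.1, x.2 - y.2).

Definition enorm (x : P) : R := Num.sqrt (x.1 ^+ 2 + x.2 ^+ 2).

Definition leb2 := ((@lebesgue_measure R) \x (@lebesgue_measure R))%E.

Definition bdry (D : set P) : set P := closure D `\` D.

Definition bounded_set2 (D : set P) : Prop :=
  exists M : R, forall x, D x -> enorm x <= M.

Definition domain2 (D : set P) : Prop := open D /\ connected D /\ D !=set0.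

Definition unit_sq : set P := [set p | p.1 \in `[0, 1] /\ p.2 \in `[0, 1]].
Definition simply_connected2 (D : set P) : Prop :=
  connected D /\
  forall g : R -> P,
    {within `[0, 1], continuous g} ->
    (forall s, s \in `[0, 1] -> D (g s)) ->
    g 0 = g 1 ->
    exists H : P -> P,
      {within unit_sq, continuous H} /\
      (forall p, unit_sq p -> D (H p)) /\
      (forall s, s \in `[0, 1] -> H (s, 0) = g s /\ H (s, 1) = g 0) /\
      (forall t, t \in `[0, 1] -> H (0, t) = g 0 /\ H (1, t) = g 0).

(* C^1 boundary: near each boundary point p, after a rotation by some angle
   th, D is the strict epigraph of a C^1 function g. Local coordinates of x:
   u = cos th (x1-p1) + sin th (x2-p2), v = - sin th (x1-p1) + cos th (x2-p2). *)
Definition rot_u (th : R) (z : P) : R := cos th * z.1 + sin th * z.2.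
Definition rot_v (th : R) (z : P) : R := - sin th * z.1 + cos th * z.2.
Definition C1_boundary (D : set P) : Prop :=
  forall p, bdry D p ->
    exists r : R, exists th : R, exists g : R -> R,
      0 < r /\
      (forall t, derivable g t 1) /\ continuous (derive1 g) /\
      forall x, enorm (psub x p) < r ->
        (D x <-> g (rot_u th (psub x p)) < rot_v th (psub x p)).

Definition barycenter_zero (D : set P) : Prop :=
  Rintegral leb2 D (fun y => y.1) = 0 /\ Rintegral leb2 D (fun y => y.2) = 0.

Definition stream (D : set P) (x : P) : R :=
  (2 * pi)^-1 * Rintegral leb2 D (fun y => ln (enorm (psub x y))).

Definition disc (c : P) (r : R) : set P := [set x | enorm (psub x c) < r].

End Plane.

(* Main.v *)
(* Write V_E for the integral over E of log |x - y|, so that V_D = 2 pi psi. On a disc B the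
   function V_B - pi |x|^2 / 2 is constant, by averaging over rotations. Hence
   V_D - pi |x|^2 / 2 has vanishing Laplacian in D, and by the maximum principle it is at
   most its boundary value c in D. Let p be a point of the closure of D farthest from 0,
   rho = |p|, B the disc of radius rho about 0 and E = B \ D. The normal to the boundary at p
   is radial, so (1 - t) p lies in D for small t, and comparing V_D with V_B gives
   V_E(p) - V_E((1 - t) p) <= C t^2. But p . (p - y) >= |p - y|^2 / 2 for |y| <= rho, so
   that difference is also at least about t |E| / 2. Therefore E is null, and since
   D has no boundary of slit type, D = B. *)
Require Import Defs.
From mathcomp Require Import all_boot all_order all_algebra.
From mathcomp Require Import all_classical all_reals all_analysis.
From mathcomp Require Import measurable_realfun ring lra.
Import Order.TTheory GRing.Theory Num.Theory.
Import numFieldNormedType.Exports.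
Set Implicit Arguments.
Unset Strict Implicit.
Unset Printing Implicit Defensive.
Local Open Scope classical_set_scope.
Local Open Scope ring_scope.

(** The average over rotations is taken over finitely many of them. With N = 2^m, the product of x -
    z y over the N-th roots of unity z is x^N - y^N, whose modulus is max(|x|, |y|)^N up to a factor
    bounded independently of m, as long as the ratio of |x| and |y| stays away from 1. Taking
    logarithms, dividing by N and letting m grow turns log |x - y| into log max(|x|, |y|) over
    radial sets that avoid an annulus around |x|. This rests on the invariance of area under
    rotations, which are products of shears, and shears preserve area by Fubini. The Laplacian is
    replaced by a four-point sum, so that the maximum principle applies to potentials known only to
    be Lipschitz; the behaviour of V_B enters it as a lower bound at four points around the centre
    of a small disc. In the last comparison the logarithm is singular near p. The part of E at
    distance of order sqrt(t) from p is estimated separately and costs an error of order t^(3/2),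
    which is still negligible against t |E|. Hence the parameter s with t = s^2. *)

Notation plane_measure R :=
  ((@lebesgue_measure R \x @lebesgue_measure R)%E) (only parsing).
Notation mplane R := (measurableTypeR R * measurableTypeR R)%type (only parsing).

(** * Measurability of open sets; invariance of area under shears and the swap *)

Section Measurability.
Variable R : realType.
Local Notation P := (R * R)%type.
Local Notation T := (mplane R).

(** Measurability refers to the product sigma-algebra, so [D] is written as a countable union of
    open squares with rational centres and radii [n.+1%:R^-1]. *)
Lemma open_measurable2 (D : set P) : open D -> measurable (D : set T).
Proof.
move=> oD.
pose box (q : rat * rat) (n : nat) : set P :=
  [set y | `|y.1 - ratr q.1| < n.+1%:R^-1] `&` [set y | `|y.2 - ratr q.2| < n.+1%:R^-1].
pose F q n : set T := [set y | box q n `<=` D /\ box q n y].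
have -> : D = \bigcup_q \bigcup_n F q n.
  apply/seteqP; split => [x Dx|x [q _ [n _]]]; last first.
    by move=> [s]; exact: s.
  have /nbhs_ballP[e /= e0 be] : nbhs x D by exact: open_nbhs_nbhs.
  have [n ne] : exists n, n.+1%:R^-1 + n.+1%:R^-1 < e :> R.
    have e2 : 0 < e / 2 by rewrite divr_gt0.
    exists (Num.truncn (e / 2)^-1); set n := Num.truncn _.
    have : (n.+1)%:R^-1 < e / 2 :> R.
      by rewrite invf_plt ?posrE// truncnS_gt.
    by rewrite [X in _ -> _ < X]splitr => h; apply: ltrD; apply: h.
  have n0 : 0 < n.+1%:R^-1 :> R by rewrite invr_gt0.
  have ap (z : R) : exists q : rat, `|z - ratr q| < n.+1%:R^-1.
    have [|q] := @rat_in_itvoo R (z - n.+1%:R^-1) (z + n.+1%:R^-1).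
      by rewrite ltrD2l gtrN.
    rewrite in_itv/= => /andP[h1 h2]; exists q.
    by rewrite ltr_norml ltrNl opprB [X in X && _]ltrBlDl h2 ltrBlDr -ltrBlDl h1.
  have [q1 h1] := ap x.1; have [q2 h2] := ap x.2.
  exists (q1, q2) => //; exists n => //; split; last by split.
  move=> y /= [y1 y2]; apply: be; split; rewrite /ball/=.
    rewrite (_ : x.1 - y.1 = (x.1 - ratr q1) - (y.1 - ratr q1)); last by ring.
    by apply: (le_lt_trans (ler_normB _ _)); apply: lt_trans ne; apply: ltrD.
  rewrite (_ : x.2 - y.2 = (x.2 - ratr q2) - (y.2 - ratr q2)); last by ring.
  by apply: (le_lt_trans (ler_normB _ _)); apply: lt_trans ne; apply: ltrD.
apply: countable_bigcupT_measurable => [|q]; first exact: countableP.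
apply: bigcupT_measurable => n; have [bD|nbD] := pselect (box q n `<=` D); last first.
  by rewrite (_ : F q n = set0)//; apply/seteqP; split => // y [].
rewrite (_ : F q n = box q n); last by apply/seteqP; split => // y [].
have mb (z : R) : measurable ([set y : R | `|y - z| < n.+1%:R^-1] : set (measurableTypeR R)).
  rewrite (_ : [set y : R | _] = ball z n.+1%:R^-1); first exact: measurable_ball.
  by apply/seteqP; split => y /=; rewrite /ball/= distrC.
apply: measurableI.
  rewrite -[X in measurable X]setTI.
  exact: (@measurable_fst _ _ (measurableTypeR R) (measurableTypeR R) measurableT _ (mb (ratr q.1))).
rewrite -[X in measurable X]setTI.
exact: (@measurable_snd _ _ (measurableTypeR R) (measurableTypeR R) measurableT _ (mb (ratr q.2))).
Qed.

Lemma lebesgue_measure_translation (a : R) (A : set R) : measurable A ->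
  lebesgue_measure ((fun y : R => y + a) @^-1` A) = lebesgue_measure A.
Proof.
move=> mA; have mf : measurable_fun setT (fun y : measurableTypeR R => (y + a : measurableTypeR R)).
  by apply: measurable_funD => //; exact: measurable_id.
pose f : measurableTypeR R -> measurableTypeR R := fun y => y + a.
rewrite -[LHS]/(pushforward (@lebesgue_measure R) f A).
apply/esym/lebesgue_measure_unique => //= _ [[u v]] _ <-; rewrite /pushforward.
have -> : f @^-1` `]u, v] = `]u - a, v - a]%classic.
  apply/seteqP; split => x /=; rewrite /f !in_itv/= => /andP[h1 h2].
    by rewrite ltrBlDr h1 lerBrDr h2.
  by rewrite -ltrBlDr h1 -lerBrDr h2.
rewrite !lebesgue_measure_itv/= !lte_fin ltrD2r; case: ifP => // _.
by rewrite -!EFinB; congr EFin; ring.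
Qed.

Lemma shear_measurable (phi : R -> R) : measurable_fun setT phi ->
  measurable_fun [set: T] (fun y : T => (y.1, y.2 + phi y.1) : T).
Proof.
move=> mphi; apply: measurable_fun_pair; first exact: measurable_fst.
apply: measurable_funD; first exact: measurable_snd.
by apply: measurableT_comp => //; exact: measurable_fst.
Qed.

(** Each vertical section of the preimage is a translate of the corresponding section of [A]. *)
Lemma plane_measure_shear (phi : R -> R) (A : set T) :
  measurable_fun setT phi -> measurable A ->
  plane_measure R ((fun y : T => (y.1, y.2 + phi y.1) : T) @^-1` A) = plane_measure R A.
Proof.
move=> mphi mA; rewrite /product_measure1; apply: eq_integral => x _ /=.
rewrite -[RHS](lebesgue_measure_translation (phi x)); last exact: measurable_xsection.
by congr lebesgue_measure; apply/seteqP; split => y /=; rewrite !/(xsection _ _) /= !inE.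
Qed.

Lemma swap_measurable : measurable_fun [set: T] (fun y : T => (y.2, y.1) : T).
Proof. by apply: measurable_fun_pair; [exact: measurable_snd|exact: measurable_fst]. Qed.

Lemma plane_measure_swap (A : set T) : measurable A ->
  plane_measure R ((fun y : T => (y.2, y.1) : T) @^-1` A) = plane_measure R A.
Proof.
move=> mA.
pose f : T -> T := fun y => (y.2, y.1); have mf := swap_measurable.
rewrite -[LHS]/(pushforward (plane_measure R) f A).
apply/esym/product_measure_unique => //= X Y mX mY; rewrite /pushforward.
have -> : f @^-1` (X `*` Y) = Y `*` X by apply/seteqP; split => y /= [].
by rewrite product_measure1E// muleC.
Qed.
End Measurability.

(** * Area-preserving maps: shears, translations, rotations *)

Section MeasurePreserving.
Variable R : realType.
Local Notation P := (R * R)%type.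
Local Notation T := (mplane R).
Local Notation mu := (plane_measure R).

Definition measure_preserving (f : P -> P) :=
  measurable_fun [set: T] (f : T -> T) /\
  forall A : set T, measurable A -> mu (f @^-1` A) = mu A.

Lemma measure_preserving_comp (f g : P -> P) :
  measure_preserving f -> measure_preserving g -> measure_preserving (f \o g).
Proof.
move=> [mf pf] [mg pg]; split; first exact: measurableT_comp.
move=> A mA; rewrite comp_preimage pg ?pf//.
by rewrite -[X in measurable X]setTI; exact: mf.
Qed.

Lemma measure_preserving_shear (phi : R -> R) : measurable_fun setT phi ->
  measure_preserving (fun y : P => (y.1, y.2 + phi y.1)).
Proof.
by move=> mphi; split; [exact: shear_measurable|move=> A; exact: plane_measure_shear].
Qed.

Lemma measure_preserving_swap : measure_preserving (fun y : P => (y.2, y.1)).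
Proof. by split; [exact: swap_measurable|exact: plane_measure_swap]. Qed.

Lemma measure_preserving_shear_swap (phi : R -> R) : measurable_fun setT phi ->
  measure_preserving (fun y : P => (y.1 + phi y.2, y.2)).
Proof.
move=> mphi; have := measure_preserving_comp measure_preserving_swap
  (measure_preserving_comp (measure_preserving_shear mphi) measure_preserving_swap).
by congr measure_preserving; apply/funext => -[].
Qed.

Lemma measure_preserving_translation (a : P) :
  measure_preserving (fun y : P => (y.1 + a.1, y.2 + a.2)).
Proof.
have := measure_preserving_comp
  (measure_preserving_shear (phi := cst a.2) (measurable_cst _))
  (measure_preserving_shear_swap (phi := cst a.1) (measurable_cst _)).
by congr measure_preserving; apply/funext => -[].
Qed.

Definition rotation (z : P) (y : P) : P :=
  (z.1 * y.1 - z.2 * y.2, z.2 * y.1 + z.1 * y.2).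

Lemma measurable_mulr_cst (l : R) : measurable_fun setT (fun t : R => l * t).
Proof. exact: mulrl_measurable. Qed.

(* A rotation that is not a homothety is the product of three shears. *)
Lemma measure_preserving_rotation (z : P) :
  z.1 ^+ 2 + z.2 ^+ 2 = 1 -> measure_preserving (rotation z).
Proof.
have rot0 w : w.1 ^+ 2 + w.2 ^+ 2 = 1 -> w.2 != 0 -> measure_preserving (rotation w).
  (* For an angle with cosine [a] and sine [b], [l] is minus the tangent of half the angle; the
     shears have slopes [l], [b], [l]. *)
  case: w => a b /= ab b0; pose l := (a - 1) / b.
  have lb : l * b = a - 1 by rewrite /l divfK.
  have l2 : l * (a + 1) = - b.
    apply: (mulIf b0); rewrite mulrAC lb.
    by transitivity (a ^+ 2 - 1); [ring|rewrite -ab; ring].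
  have := measure_preserving_comp (measure_preserving_shear_swap (measurable_mulr_cst l))
   (measure_preserving_comp (measure_preserving_shear (measurable_mulr_cst b))
     (measure_preserving_shear_swap (measurable_mulr_cst l))).
  congr measure_preserving; apply/funext => -[x y]; rewrite /rotation/=; congr pair.
    transitivity (x * (1 + l * b) + y * (l * (2 + l * b))); first ring.
    rewrite lb (_ : 1 + (a - 1) = a); last by ring.
    rewrite (_ : 2 + (a - 1) = a + 1); last by ring.
    by rewrite l2; ring.
  transitivity (b * x + y * (1 + l * b)); first ring.
  by rewrite lb; ring.
(* When [z.2 = 0] there remain the identity and the half turn, which is the square of the quarter
   turn [(0, 1)]. *)
have [z0 zz|z0 /rot0] := eqVneq z.2 0; last exact.
have ii : measure_preserving (rotation (0, 1)).
  by apply: rot0 => /=; rewrite ?oner_neq0// expr0n expr1n add0r.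
move: zz; rewrite z0 expr0n addr0 => /eqP; rewrite sqrf_eq1 => /orP[]/eqP z1.
  split.
    rewrite (_ : rotation z = id); first exact: measurable_id.
    by apply/funext => -[x y]; rewrite /rotation z0 z1/=; congr pair; ring.
  move=> A _; congr (mu _); apply/seteqP; split => -[x y] /=;
    by rewrite /rotation z0 z1/= !mul1r !mul0r subr0 add0r.
have := measure_preserving_comp ii ii; congr measure_preserving.
by apply/funext => -[x y]; rewrite /rotation z0 z1/=; congr pair; ring.
Qed.

Section integrals.
Variables (f : P -> P) (A : set T) (g : P -> R).
Hypotheses (mpf : measure_preserving f) (mA : measurable A)
  (mg : measurable_fun [set: T] g).

Lemma integrable_preserving : mu.-integrable A (EFin \o g) ->
  mu.-integrable (f @^-1` A) (EFin \o (g \o f)).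
Proof.
move=> /integrableP[_ gi]; apply/integrableP; split.
  apply/measurable_EFinP; apply: (@measurable_funS _ _ _ _ setT) => //.
  by apply: measurableT_comp => //; exact: mpf.1.
apply: le_lt_trans gi; rewrite le_eqVlt; apply/orP; left; apply/eqP.
transitivity (\int[pushforward mu (f : T -> T)]_(y in A) `|(g y)%:E|)%E; last first.
  apply: eq_measure_integral; first exact: mpf.1.
  by move=> ? B mB _; exact: mpf.2.
rewrite ge0_integral_pushforward//; first exact: mpf.1.
apply/measurableT_comp => //; apply/measurable_EFinP.
exact: (@measurable_funS _ _ _ _ setT).
Qed.

Lemma Rintegral_preserving : mu.-integrable A (EFin \o g) ->
  \int[mu]_(y in f @^-1` A) g (f y) = \int[mu]_(y in A) g y.
Proof.
move=> gi; rewrite /Rintegral; congr fine.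
transitivity (\int[pushforward mu (f : T -> T)]_(y in A) (g y)%:E)%E; last first.
  apply: eq_measure_integral; first exact: mpf.1.
  by move=> ? B mB _; exact: mpf.2.
rewrite integral_pushforward//; first exact: mpf.1.
  exact/measurable_EFinP.
exact: integrable_preserving.
Qed.
End integrals.
End MeasurePreserving.

(** * Area of a disc *)

Section DiscArea.
Variable R : realType.
Local Notation P := (R * R)%type.
Local Notation T := (mplane R).
Local Notation mu := (plane_measure R).

Lemma measurable_enorm : measurable_fun [set: T] (@enorm R : T -> R).
Proof.
change (measurable_fun [set: T] (fun y : T => Num.sqrt (y.1 ^+ 2 + y.2 ^+ 2))).
apply: measurableT_comp.
  by apply: continuous_measurable_fun; exact: sqrt_continuous.
by apply: measurable_funD; apply: measurable_funX.
Qed.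

Lemma measurable_psub (c : P) : measurable_fun [set: T] (fun y => psub y c : T).
Proof.
by apply: measurable_fun_pair; apply: measurable_funB.
Qed.

Lemma psub_enormC (x y : P) : enorm (psub x y) = enorm (psub y x).
Proof. by rewrite /enorm /psub /= -(opprB y.1) -(opprB y.2) !sqrrN. Qed.

Lemma measurable_edist (c : P) : measurable_fun [set: T] (fun y => enorm (psub c y)).
Proof.
rewrite (_ : (fun _ => _) = @enorm R \o (fun y => psub y c)).
  by apply: measurableT_comp; [exact: measurable_enorm|exact: measurable_psub].
by apply/funext => y /=; rewrite psub_enormC.
Qed.

Lemma measurable_disc (c : P) (r : R) : measurable (disc c r : set T).
Proof.
rewrite (_ : disc c r = setT `&` (fun y => enorm (psub c y)) @^-1` `]-oo, r[).
  by apply: measurable_edist.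
by rewrite setTI; apply/seteqP; split => y /=; rewrite in_itv/= psub_enormC.
Qed.

Lemma Rcos2_integral (r : R) : 0 < r ->
  (\int[@lebesgue_measure R]_(t in `[(- (pi / 2))%R, (pi / 2)%R])
     (2 * r ^+ 2 * cos t ^+ 2)%:E = (pi * r ^+ 2)%:E)%E.
Proof.
move=> r0; have pi2 : - (pi / 2) < pi / 2 :> R by rewrite gtrN// divr_gt0// pi_gt0.
pose H := fun t : R => r ^+ 2 * (t + sin t * cos t) : R.
have dH (t : R) : is_derive t 1 H (2 * r ^+ 2 * cos t ^+ 2).
  apply: is_derive_eq; rewrite /GRing.scale/=.
  by rewrite [in LHS]mulrN -!expr2 (sin2cos2 t); ring.
have cH : continuous H.
  by move=> t; apply: differentiable_continuous; apply/derivable1_diffP; apply: ex_derive.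
rewrite (@continuous_FTC2 _ _ H)//.
- rewrite /H sinN cosN sin_pihalf cos_pihalf -EFinB; congr EFin.
  by rewrite !mulr0 !addr0; field.
- apply: continuous_subspaceT => t.
  by apply: differentiable_continuous; apply/derivable1_diffP; apply: ex_derive.
- split => //.
  + by apply: cvg_at_right_filter; exact: cH.
  + by apply: cvg_at_left_filter; exact: cH.
- by move=> t _; rewrite derive1E; exact: derive_val.
Qed.

(** This covers |x| >= r as well: the section is then empty, and [Num.sqrt] is 0 on nonpositive
    numbers. *)
Lemma lebesgue_measure_disc_section (r x : R) : 0 < r ->
  lebesgue_measure (xsection (disc (0 : P) r) x) = (2 * Num.sqrt (r ^+ 2 - x ^+ 2))%:E.
Proof.
move=> r0; set s := Num.sqrt _.
have -> : xsection (disc (0 : P) r) x = `]- s, s[%classic.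
  apply/seteqP; split => y; rewrite /xsection/= inE /disc/= in_itv/= -ltr_norml.
    rewrite /enorm/psub/= !subr0 -[r in _ < r](@gtr0_norm _ r)// -sqrtr_sqr.
    rewrite ltr_sqrt ?exprn_gt0// => h.
    have h0 : 0 < r ^+ 2 - x ^+ 2 by rewrite subr_gt0; apply: le_lt_trans h; rewrite lerDl sqr_ge0.
    by rewrite /s -sqrtr_sqr ltr_sqrt// ltrBrDl.
  rewrite /s -sqrtr_sqr => h.
  have h0 : 0 < r ^+ 2 - x ^+ 2.
    rewrite ltNge; apply/negP => h0; move: h; rewrite (ler0_sqrtr h0).
    by rewrite ltNge sqrtr_ge0.
  rewrite /enorm/psub/= !subr0 -[r in _ < r](@gtr0_norm _ r)// -sqrtr_sqr.
  by rewrite ltr_sqrt ?exprn_gt0// -ltrBrDl -ltr_sqrt.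
rewrite lebesgue_measure_itv/= lte_fin.
have [h|h] := ltP (- s) s; first by rewrite -EFinB; congr EFin; ring.
have s0 : 0 <= s := sqrtr_ge0 _.
by congr EFin; lra.
Qed.

(** Fubini gives the integral of the section lengths, and the substitution x = r sin t turns it into
    [Rcos2_integral]. *)
Lemma plane_measure_disc0 (r : R) : 0 < r -> mu (disc 0 r) = (pi * r ^+ 2)%:E.
Proof.
move=> r0; have pi2 : - (pi / 2) < pi / 2 :> R by rewrite gtrN// divr_gt0// pi_gt0.
transitivity (\int[@lebesgue_measure R]_x (2 * Num.sqrt (r ^+ 2 - x ^+ 2))%:E)%E.
  by apply: eq_integral => x _ /=; rewrite lebesgue_measure_disc_section.
transitivity (\int[@lebesgue_measure R]_(x in `[(- r)%R, r]) (2 * Num.sqrt (r ^+ 2 - x ^+ 2))%:E)%E.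
  rewrite [RHS]integral_mkcond; apply: eq_integral => x _; rewrite /patch.
  case: ifPn => //; rewrite notin_setE/= in_itv/= -ler_norml => /negP; rewrite -ltNge => h.
  rewrite ler0_sqrtr ?mulr0// subr_le0 -[x ^+ 2]real_normK ?num_real//.
  by rewrite ler_pXn2r// ?nnegrE// ltW.
pose F := fun t : R => r * sin t : R.
have dF (t : R) : is_derive t 1 F (r * cos t).
  by apply: is_derive_eq; rewrite /GRing.scale/=; ring.
have dFE : F^`()%classic = fun t => r * cos t.
  by apply/funext => t; rewrite derive1E; exact: derive_val.
have cF : continuous F.
  by move=> t; apply: differentiable_continuous; apply/derivable1_diffP; apply: ex_derive.
have cdF : continuous (fun t : R => r * cos t).
  by move=> t; apply: cvgM; [exact: cvg_cst|exact: continuous_cos].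
rewrite -(Rcos2_integral r0).
have Fr : F (pi / 2) = r by rewrite /F sin_pihalf mulr1.
have FNr : F (- (pi / 2)) = - r by rewrite /F sinN sin_pihalf mulrN mulr1.
rewrite -[in LHS]FNr -[X in Interval _ (BRight X)]Fr.
rewrite integration_by_substitution_increasing ?dFE.
- apply: eq_integral => t; rewrite inE/= in_itv/= => tpi; congr EFin => /=.
  rewrite /F !fctE (_ : r ^+ 2 - _ = (r * cos t) ^+ 2).
    rewrite sqrtr_sqr ger0_norm ?mulr_ge0// ?(ltW r0)// ?cos_ge0_pihalf//.
    by rewrite /= ?fctE; ring.
  by rewrite !exprMn cos2sin2; ring.
- exact: ltW.
- by move=> x y xi yi xy; rewrite /F ltr_pM2l// ltr_sin.
- by move=> t _; exact: cdF.
- by apply/cvg_ex; eexists; apply: cvg_at_right_filter; exact: cdF.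
- by apply/cvg_ex; eexists; apply: cvg_at_left_filter; exact: cdF.
- split => //.
  + by apply: cvg_at_right_filter; exact: cF.
  + by apply: cvg_at_left_filter; exact: cF.
- apply: continuous_subspaceT => t.
  apply: cvgM; first exact: cvg_cst.
  apply: (@continuous_comp _ _ _ (fun t : R => r ^+ 2 - t ^+ 2) Num.sqrt); last exact: sqrt_continuous.
  by apply: differentiable_continuous; apply/derivable1_diffP; apply: ex_derive.
Qed.

Lemma disc_translation (c : P) (r : R) :
  (fun y : P => (y.1 + c.1, y.2 + c.2)) @^-1` disc c r = disc 0 r.
Proof. by apply/seteqP; split => y; rewrite /disc/= /psub/= !addrK !subr0 -surjective_pairing. Qed.

Lemma plane_measure_disc (c : P) (r : R) : 0 < r -> mu (disc c r) = (pi * r ^+ 2)%:E.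
Proof.
move=> r0; rewrite -(plane_measure_disc0 r0) -(disc_translation c).
by rewrite (measure_preserving_translation c).2//; exact: measurable_disc.
Qed.
End DiscArea.

(** * The Euclidean norm and distance *)

Section EuclideanNorm.
Variable R : realType.
Local Notation P := (R * R)%type.
Implicit Types x y z : P.

Lemma enorm_ge0 x : 0 <= enorm x.
Proof. exact: sqrtr_ge0. Qed.

Lemma sqr_enorm x : enorm x ^+ 2 = x.1 ^+ 2 + x.2 ^+ 2.
Proof. by rewrite sqr_sqrtr// addr_ge0// sqr_ge0. Qed.

Lemma enorm0_eq0 x : enorm x = 0 -> x = 0.
Proof.
move=> x0; have := sqr_enorm x; rewrite x0 expr0n/= => /esym/eqP.
rewrite paddr_eq0 ?sqr_ge0// !sqrf_eq0 => /andP[/eqP h1 /eqP h2].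
by rewrite [x]surjective_pairing h1 h2.
Qed.

Lemma eq_enorm x y : x.1 ^+ 2 + x.2 ^+ 2 = y.1 ^+ 2 + y.2 ^+ 2 -> enorm x = enorm y.
Proof. by rewrite /enorm => ->. Qed.

Lemma ler_enormD x y : enorm (x + y) <= enorm x + enorm y.
Proof.
rewrite -(ler_pXn2r (n := 2))// ?nnegrE ?addr_ge0 ?enorm_ge0//.
rewrite sqrrD !sqr_enorm /=.
have h : x.1 * y.1 + x.2 * y.2 <= enorm x * enorm y.
  apply: (le_trans (ler_norm _)); rewrite -(ler_pXn2r (n := 2))// ?nnegrE ?mulr_ge0 ?enorm_ge0//.
  rewrite real_normK ?num_real// exprMn !sqr_enorm.
  rewrite -subr_ge0 (_ : _ - _ = (x.1 * y.2 - x.2 * y.1) ^+ 2) ?sqr_ge0//; ring.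
move: (enorm x * enorm y) h => p h; nra.
Qed.

Lemma enormN x : enorm (- x) = enorm x.
Proof. by apply: eq_enorm; rewrite /= !sqrrN. Qed.

Lemma psubE x y : psub x y = x - y. Proof. by []. Qed.

Lemma edist_triangle x y z : enorm (psub x z) <= enorm (psub x y) + enorm (psub y z).
Proof. by rewrite !psubE -(subrKA y x (- z)) ler_enormD. Qed.

Lemma edist_self x : enorm (psub x x) = 0.
Proof. by rewrite /enorm/psub/= !subrr expr0n/= addr0 sqrtr0. Qed.

Lemma edist0_eq x y : enorm (psub x y) = 0 -> x = y.
Proof. by rewrite psubE => /enorm0_eq0/eqP; rewrite subr_eq0 => /eqP. Qed.

Lemma ler_edist_sub x y z :
  `|enorm (psub x y) - enorm (psub z y)| <= enorm (psub x z).
Proof.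
rewrite ler_norml; apply/andP; split.
  have := edist_triangle z x y; rewrite (psub_enormC z x); lra.
by have := edist_triangle x z y; lra.
Qed.
End EuclideanNorm.

(** * Integrals over bounded sets and the singularity 1 / |x - y| *)

Section PlaneIntegrals.
Variable R : realType.
Local Notation P := (R * R)%type.
Local Notation T := (mplane R).
Local Notation mu := (plane_measure R).

Definition bounded_measurable (E : set P) :=
  measurable (E : set T) /\ exists2 M : R, 0 < M & E `<=` disc 0 M.

Lemma bounded_measurable_disc (c : P) r : bounded_measurable (disc c r).
Proof.
split; first exact: measurable_disc.
exists (enorm c + `|r| + 1); first by rewrite ltr_wpDl// addr_ge0// enorm_ge0.
move=> y; rewrite /disc/= => yr; apply: (le_lt_trans (edist_triangle _ c _)).
rewrite [enorm (psub c 0)](_ : _ = enorm c); last by rewrite psubE subr0.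
by have := ler_norm r; lra.
Qed.

Lemma bounded_measurableS (E F : set P) :
  bounded_measurable F -> measurable (E : set T) -> E `<=` F -> bounded_measurable E.
Proof. by move=> [_ [M M0 FM]] mE EF; split => //; exists M => // y /EF/FM. Qed.

Lemma bounded_measurable_lty (E : set P) : bounded_measurable E -> (mu E < +oo)%E.
Proof.
move=> [mE [M M0 EM]]; apply: (@le_lt_trans _ _ (mu (disc 0 M))).
  by apply: le_measure => //; rewrite inE//; exact: measurable_disc.
by rewrite plane_measure_disc// ltry.
Qed.

Definition area (E : set P) : R := fine (mu E).

Lemma area_ge0 E : 0 <= area E.
Proof. exact: fine_ge0. Qed.

Lemma areaE E : bounded_measurable E -> (area E)%:E = mu E.
Proof. by move=> bE; rewrite fineK// ge0_fin_numE// bounded_measurable_lty. Qed.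

Lemma le_area (E F : set P) : bounded_measurable F -> measurable (E : set T) ->
  E `<=` F -> area E <= area F.
Proof.
move=> bF mE EF; rewrite -lee_fin !areaE//; last exact: bounded_measurableS bF mE EF.
by apply: le_measure => //; rewrite inE//; exact: bF.1.
Qed.

Lemma area_disc (c : P) r : 0 < r -> area (disc c r) = pi * r ^+ 2.
Proof. by move=> r0; rewrite /area plane_measure_disc. Qed.

Lemma area_setU (E F : set P) : bounded_measurable E -> bounded_measurable F ->
  E `&` F = set0 -> area (E `|` F) = area E + area F.
Proof.
move=> bE bF EF; rewrite /area (_ : mu (E `|` F) = mu E + mu F)%E.
  by rewrite fineD// -?(areaE bE) -?(areaE bF).
by apply: measureU => //; [exact: bE.1|exact: bF.1].
Qed.

Lemma bounded_integrable (E : set P) (g : P -> R) C : bounded_measurable E ->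
  measurable_fun [set: T] g -> (forall y, E y -> `|g y| <= C) ->
  mu.-integrable E (EFin \o g).
Proof.
move=> bE mg gC; apply: measurable_bounded_integrable.
- exact: bE.1.
- exact: bounded_measurable_lty.
- exact: measurable_funS mg.
- by exists C; split; [exact: num_real|move=> M CM y Ey; apply: le_trans (ltW CM); exact: gC].
Qed.

Lemma integrable_dominated (E : set P) (f g : P -> R) : measurable (E : set T) ->
  measurable_fun [set: T] f -> mu.-integrable E (EFin \o g) ->
  (forall y, E y -> `|f y| <= g y) -> mu.-integrable E (EFin \o f).
Proof.
move=> mE mf gi fg; apply: le_integrable gi => //.
  by apply/measurable_EFinP; exact: measurable_funS mf.
move=> y Ey /=; rewrite lee_fin; apply: (le_trans (fg _ Ey)); exact: ler_norm.
Qed.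

Lemma integrableD_EFin (E : set P) (f g : P -> R) : measurable (E : set T) ->
  mu.-integrable E (EFin \o f) -> mu.-integrable E (EFin \o g) ->
  mu.-integrable E (EFin \o (fun y => f y + g y)).
Proof.
move=> mE fi gi; rewrite (_ : EFin \o _ = (EFin \o f) \+ (EFin \o g))%E//.
exact: integrableD.
Qed.

Lemma integrableB_EFin (E : set P) (f g : P -> R) : measurable (E : set T) ->
  mu.-integrable E (EFin \o f) -> mu.-integrable E (EFin \o g) ->
  mu.-integrable E (EFin \o (fun y => f y - g y)).
Proof.
move=> mE fi gi; rewrite (_ : EFin \o _ = (EFin \o f) \- (EFin \o g))%E//.
exact: integrableB.
Qed.

Lemma integrableZ_EFin (E : set P) (k : R) (f : P -> R) : measurable (E : set T) ->
  mu.-integrable E (EFin \o f) -> mu.-integrable E (EFin \o (fun y => k * f y)).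
Proof.
move=> mE fi; rewrite (_ : EFin \o _ = (fun y => k%:E * (EFin \o f) y)%E)//.
exact: integrableZl.
Qed.

Lemma Rintegral_negligible (E N : set P) (f : P -> R) : measurable (E : set T) ->
  measurable (N : set T) -> mu N = 0%E -> mu.-integrable E (EFin \o f) ->
  \int[mu]_(y in E) f y = \int[mu]_(y in E `\` N) f y.
Proof. by move=> mE mN N0 fi; rewrite /Rintegral (negligible_integral mN). Qed.

Lemma measurable_point (x : P) : measurable ([set x] : set T).
Proof.
rewrite (_ : [set x] = [set x.1] `*` [set x.2] :> set P); first exact: measurableX.
by apply/seteqP; split => [y /= ->//|[a b] [/= -> ->]]; rewrite -surjective_pairing.
Qed.

Lemma plane_measure_point (x : P) : mu [set x] = 0%E.
Proof.
rewrite (_ : [set x] = [set x.1] `*` [set x.2] :> set P).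
  apply: (eq_trans (product_measure1E _ _ _ _)) => //.
  rewrite (_ : _ [set x.1] = 0%E) ?mul0e//; exact: lebesgue_measure_set1.
by apply/seteqP; split => [y /= ->//|[a b] [/= -> ->]]; rewrite -surjective_pairing.
Qed.

(** Estimates for differences of log |x - y| and log |x' - y| hold away from the two poles, where
    [ln] takes its default value 0; two points are negligible. *)
Lemma le_Rintegral_ae2 (E : set P) (x x' : P) (f g : P -> R) : measurable (E : set T) ->
  mu.-integrable E (EFin \o f) -> mu.-integrable E (EFin \o g) ->
  (forall y, E y -> x <> y -> x' <> y -> f y <= g y) ->
  \int[mu]_(y in E) f y <= \int[mu]_(y in E) g y.
Proof.
move=> mE fi gi fg; pose N : set T := [set x] `|` [set x'].
have mN : measurable N by apply: measurableU; exact: measurable_point.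
have N0 : mu N = 0%E.
  by apply: null_set_setU; [exact: measurable_point|exact: measurable_point|
    exact: plane_measure_point|exact: plane_measure_point].
have mEN : measurable (E `\` N : set T) by exact: measurableD.
rewrite (Rintegral_negligible mE mN N0 fi) (Rintegral_negligible mE mN N0 gi).
apply: le_Rintegral => //.
- by apply: integrableS fi => //; exact: subDsetl.
- by apply: integrableS gi => //; exact: subDsetl.
- by move=> y [Ey Ny]; apply: fg => // e; apply: Ny; [left|right]; rewrite /= e.
Qed.

Definition inv_edist (x y : P) : R := (enorm (psub x y))^-1.

Lemma inv_edist_ge0 x y : 0 <= inv_edist x y.
Proof. by rewrite invr_ge0 enorm_ge0. Qed.

Lemma measurable_inv_edist x : measurable_fun [set: T] (inv_edist x).
Proof.
(* At [y = x] the inverse of 0 is 0, whereas the exponential is 1 because [ln 0 = 0]; the indicator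
   corrects this. *)
rewrite (_ : inv_edist x = fun y => \1_(~` [set x]) y * expR (- ln (enorm (psub x y)))).
  apply: measurable_funM.
    by apply: measurable_indic; apply: measurableC; exact: measurable_point.
  apply: measurableT_comp; first exact: measurable_expR.
  apply: measurableT_comp => //.
  by apply: measurableT_comp; [exact: measurable_ln|exact: measurable_edist].
apply/funext => y; rewrite indicE /inv_edist.
have := enorm_ge0 (psub x y); rewrite le_eqVlt => /orP[/eqP e|e].
  rewrite memNset; first by rewrite mul0r -e invr0.
  by move/esym/edist0_eq : e => -> /(_ erefl).
rewrite mem_set; first by rewrite mul1r expRN lnK.
by move=> yx; move: e; rewrite yx edist_self ltxx.
Qed.

Lemma dyadic_shell (a d : R) : 0 < a -> a < d ->
  exists k : nat, d / 2 ^+ k.+1 <= a /\ a < d / 2 ^+ k.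
Proof.
move=> a0 ad; have d0 := lt_trans a0 ad.
have e2 : exists n, d / 2 ^+ n <= a.
  exists (Num.truncn (d / a)).+1; set n := (Num.truncn _).+1.
  rewrite ler_pdivrMr ?exprn_gt0// mulrC -ler_pdivrMr//.
  apply: (@le_trans _ _ n%:R); first by rewrite ltW// truncnS_gt.
  by rewrite -natrX ler_nat ltnW// ltn_expl.
case: (ex_minnP e2) => -[|k] hk mk; first by move: hk; rewrite expr0 divr1 leNgt ad.
by exists k; split => //; rewrite ltNge; apply/negP => /mk; rewrite ltnn.
Qed.

Local Notation shell_weight x d k y :=
  (2 ^+ k.+1 / d * (\1_(disc x (d / 2 ^+ k)) y : R)).

(** Outside the disc of radius [d] the first term suffices. Inside, [y] lies at distance between d /
    2^(k+1) and d / 2^k for some k, and the k-th term alone suffices; at [y = x] the left side is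
    0. *)
Lemma inv_edist_le_shells (x y : P) (d : R) : 0 < d ->
  ((inv_edist x y)%:E <= (d^-1)%:E + \sum_(0 <= k <oo) (shell_weight x d k y)%:E)%E.
Proof.
move=> d0.
have w0 k : (0 <= (shell_weight x d k y)%:E)%E.
  by rewrite lee_fin mulr_ge0// divr_ge0// ?exprn_ge0// ltW.
have [h|h] := leP d (enorm (psub x y)).
  rewrite -[leLHS]adde0 leeD//; last by apply: nneseries_ge0 => k _ _; exact: w0.
  by rewrite lee_fin /inv_edist lef_pV2// posrE// (lt_le_trans d0).
rewrite -[leLHS]add0e leeD//; first by rewrite lee_fin invr_ge0 ltW.
have := enorm_ge0 (psub x y); rewrite le_eqVlt => /orP[/eqP e|p].
  by rewrite /inv_edist -e invr0; apply: nneseries_ge0 => k _ _; exact: w0.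
have [k [k1 k2]] := dyadic_shell p h.
apply: (@le_trans _ _ (\sum_(0 <= i < k.+1) (shell_weight x d i y)%:E)%E); last first.
  by apply: nneseries_lim_ge => i _ _; exact: w0.
rewrite big_nat_recr//= -[leLHS]add0e leeD//; first by apply: sume_ge0 => i _; exact: w0.
rewrite lee_fin indicE mem_set ?mulr1; last by rewrite /disc/= psub_enormC.
rewrite /inv_edist -[leRHS]invrK lef_pV2 ?posrE ?invr_gt0 ?divr_gt0 ?exprn_gt0//.
by rewrite invf_div.
Qed.

(** The k-th shell term integrates to at most (2^(k+1) / d) pi (d / 2^k)^2 = 2 pi d / 2^k, and these
    sum to 4 pi d. The radius [d] is left free so that the bound can be made small when [E] has
    small area. *)
Lemma integral_inv_edist_le (E : set P) (x : P) (d : R) : 0 < d ->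
  bounded_measurable E ->
  (\int[mu]_(y in E) (inv_edist x y)%:E <= (4 * pi * d + area E / d)%:E)%E.
Proof.
move=> d0 bE; have mE := bE.1.
have w0 k y : (0 <= (shell_weight x d k y)%:E)%E.
  by rewrite lee_fin mulr_ge0// divr_ge0// ?exprn_ge0// ltW.
have mw k : measurable_fun (E : set T) (fun y => (shell_weight x d k y)%:E).
  apply/measurable_EFinP; apply: measurable_funM => //.
  by apply: measurable_indic; exact: measurable_disc.
apply: (@le_trans _ _ (\int[mu]_(y in E) ((d^-1)%:E + \sum_(0 <= k <oo) (shell_weight x d k y)%:E)))%E.
  apply: ge0_le_integral => //.
  - by move=> y _; rewrite lee_fin inv_edist_ge0.
  - by apply/measurable_EFinP; exact: measurable_funS (measurable_inv_edist x).
  - apply: emeasurable_funD => //.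
    by apply: ge0_emeasurable_sum => //.
  - by move=> y _; exact: inv_edist_le_shells.
rewrite ge0_integralD//; last first.
- by apply: ge0_emeasurable_sum.
- by move=> y _; apply: nneseries_ge0 => k _ _; exact: w0.
- by move=> y _; rewrite lee_fin invr_ge0 ltW.
have -> : (\int[mu]_(y in E) (d^-1)%:E = (d^-1)%:E * mu E)%E by exact: integral_cst.
rewrite -areaE// -EFinM addrC EFinD [(_ / d)%R]mulrC leeD//.
rewrite integral_nneseries//.
have := @cvg_geometric_eseries_half R (4 * pi * d) 0; rewrite expr0 divr1 => /cvg_lim <-//.
apply: lee_nneseries => [k _ _|k _]; first exact: integral_ge0.
under eq_integral do rewrite EFinM.
rewrite ge0_integralZl//; last 2 first.
- apply/measurable_EFinP; apply: measurable_indic; exact: measurable_disc.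
- by rewrite lee_fin divr_ge0// ?exprn_ge0// ltW.
have dk : 0 < d / 2 ^+ k by rewrite divr_gt0// exprn_gt0.
rewrite integral_indic//; last exact: measurable_disc.
apply: (@le_trans _ _ ((2 ^+ k.+1 / d)%:E * mu (disc x (d / 2 ^+ k)))%E).
  apply: lee_wpmul2l; first by rewrite lee_fin divr_ge0// ?exprn_ge0// ltW.
  apply: le_measure; rewrite ?inE.
  - by apply: measurableI => //; exact: measurable_disc.
  - exact: measurable_disc.
  - exact: subIsetl.
rewrite plane_measure_disc// -EFinM lee_fin addn1 natrX le_eqVlt; apply/orP; left; apply/eqP.
rewrite exprS; field.
by rewrite (gt_eqF d0) expf_neq0.
Qed.

Lemma integrable_inv_edist (E : set P) (x : P) : bounded_measurable E ->
  mu.-integrable E (EFin \o inv_edist x).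
Proof.
move=> bE; apply/integrableP; split.
  by apply/measurable_EFinP; exact: measurable_funS (measurable_inv_edist x).
under eq_integral => y _ do rewrite /= ger0_norm ?inv_edist_ge0//.
by apply: (le_lt_trans (integral_inv_edist_le x (@ltr01 R) bE)); rewrite ltry.
Qed.

Lemma Rintegral_inv_edist_le (E : set P) (x : P) (d : R) : 0 < d ->
  bounded_measurable E ->
  \int[mu]_(y in E) inv_edist x y <= 4 * pi * d + area E / d.
Proof.
move=> d0 bE; rewrite -lee_fin /Rintegral fineK; first exact: integral_inv_edist_le.
by apply: integrable_fin_num; [exact: bE.1|exact: integrable_inv_edist].
Qed.
End PlaneIntegrals.

(** * The logarithmic potential and its Lipschitz continuity *)

Section LogarithmicPotential.
Variable R : realType.
Local Notation P := (R * R)%type.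
Local Notation T := (mplane R).
Local Notation mu := (plane_measure R).

(** At 0 both sides vanish by the default values of [ln] and of the inverse, so the bound dominates
    [log_edist] at its pole too. *)
Lemma abs_ln_le (t : R) : 0 <= t -> `|ln t| <= t + t^-1.
Proof.
rewrite le_eqVlt => /orP[/eqP <-|t0]; first by rewrite ln0// normr0 invr0 addr0.
have ti : 0 < t^-1 by rewrite invr_gt0.
have h1 := ln_sublinear t0; have := ln_sublinear ti; rewrite lnV ?posrE// => h2.
by rewrite ler_norml; apply/andP; split; lra.
Qed.

Lemma ln_sub_le (a b : R) : 0 < a -> 0 < b -> ln a - ln b <= (a - b) / b.
Proof.
move=> a0 b0; rewrite -ln_div ?posrE//.
have -> : a / b = 1 + (a - b) / b by field; rewrite gt_eqF.
apply: le_ln1Dx.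
have -> : (a - b) / b = a / b - 1 by field; rewrite gt_eqF.
by rewrite ltrBrDr addNr divr_gt0.
Qed.

Lemma abs_ln_sub_le (a b : R) : 0 < a -> 0 < b ->
  `|ln a - ln b| <= `|a - b| * (a^-1 + b^-1).
Proof.
move=> a0 b0; have h1 := ln_sub_le a0 b0; have h2 := ln_sub_le b0 a0.
have a1 : 0 < a^-1 by rewrite invr_gt0.
have b1 : 0 < b^-1 by rewrite invr_gt0.
have h := ler_norm (a - b); have h' := ler_norm (b - a); rewrite distrC in h'.
have p1 : (a - b) / b <= `|a - b| / b by apply: ler_wpM2r => //; exact: ltW.
have p2 : (b - a) / a <= `|a - b| / a by apply: ler_wpM2r => //; exact: ltW.
have p3 : 0 <= `|a - b| / a by rewrite divr_ge0// ltW.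
have p4 : 0 <= `|a - b| / b by rewrite divr_ge0// ltW.
by rewrite mulrDr ler_norml; apply/andP; split; lra.
Qed.

Definition log_edist (x y : P) : R := ln (enorm (psub x y)).

Definition potential (E : set P) (x : P) : R := \int[mu]_(y in E) log_edist x y.

Lemma measurable_log_edist x : measurable_fun [set: T] (log_edist x).
Proof.
by apply: measurableT_comp; [exact: measurable_ln|exact: measurable_edist].
Qed.

Lemma bounded_measurable_radius (E : set P) : bounded_measurable E ->
  forall x, exists2 M, 0 < M & forall y, E y -> enorm (psub x y) <= M.
Proof.
move=> [_ [M M0 EM]] x; exists (enorm x + M); first by rewrite ltr_wpDl// enorm_ge0.
move=> y /EM; rewrite /disc/= => yM; apply: (le_trans (edist_triangle _ 0 _)).
rewrite (psub_enormC 0) [enorm (psub x 0)](_ : _ = enorm x); last by rewrite psubE subr0.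
by rewrite lerD2l ltW.
Qed.

Lemma integrable_cst (E : set P) (c : R) : bounded_measurable E ->
  mu.-integrable E (EFin \o (fun=> c)).
Proof. by move=> bE; apply: (@bounded_integrable _ _ _ `|c|). Qed.

Lemma Rintegral_cst_area (E : set P) (c : R) : bounded_measurable E ->
  \int[mu]_(y in E) c = c * area E.
Proof. by move=> bE; rewrite Rintegral_cst//; exact: bE.1. Qed.

Lemma integrable_log_edist (E : set P) x : bounded_measurable E ->
  mu.-integrable E (EFin \o log_edist x).
Proof.
move=> bE; have [M M0 xM] := bounded_measurable_radius bE x.
have i1 := integrable_cst M bE; have i2 := integrable_inv_edist x bE.
apply: (@integrable_dominated _ _ _ (fun y => M + inv_edist x y)).
- exact: bE.1.
- exact: measurable_log_edist.
- by apply: integrableD_EFin => //; exact: bE.1.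
- move=> y Ey; apply: (le_trans (abs_ln_le (enorm_ge0 _))).
  by rewrite lerD2r; exact: xM.
Qed.

Lemma potential_setU (E F : set P) x : bounded_measurable E -> bounded_measurable F ->
  E `&` F = set0 -> potential (E `|` F) x = potential E x + potential F x.
Proof.
move=> bE bF EF; apply: Rintegral_setU; [exact: bE.1|exact: bF.1| |].
  apply: integrable_log_edist.
  split; first by apply: measurableU; [exact: bE.1|exact: bF.1].
  case: bE => _ [M M0 EM]; case: bF => _ [N N0 FN]; exists (M + N); first exact: addr_gt0.
  by move=> y [/EM|/FN]; rewrite /disc/= => h; apply: (lt_trans h); rewrite ?ltrDl ?ltrDr.
by rewrite disj_set2E EF eqxx.
Qed.

(** The logarithms differ by at most |x - x'| (1 / |x - y| + 1 / |x' - y|), and each inverse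
    distance integrates to at most 4 pi + area E, by the shell bound with radius 1. *)
Lemma potential_sub_le (E : set P) (x x' : P) : bounded_measurable E ->
  potential E x - potential E x' <= (2 * (4 * pi + area E)) * enorm (psub x x').
Proof.
move=> bE; have mE := bE.1.
have ix := integrable_log_edist x bE; have ix' := integrable_log_edist x' bE.
have jx := integrable_inv_edist x bE; have jx' := integrable_inv_edist x' bE.
rewrite /potential -RintegralB//.
have jj : mu.-integrable E (EFin \o (fun y => inv_edist x y + inv_edist x' y)).
  exact: integrableD_EFin.
have ji : mu.-integrable E
    (EFin \o (fun y => enorm (psub x x') * (inv_edist x y + inv_edist x' y))).
  exact: integrableZ_EFin.
apply: (@le_trans _ _ (\int[mu]_(y in E) (enorm (psub x x') * (inv_edist x y + inv_edist x' y)))).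
  apply: (@le_Rintegral_ae2 _ _ x x') => //.
    exact: integrableB_EFin.
  move=> y Ey xy x'y.
  have p (z : P) : z <> y -> 0 < enorm (psub z y).
    move=> zy; rewrite lt_neqAle enorm_ge0 andbT eq_sym; apply/eqP => /edist0_eq; exact: zy.
  apply: (le_trans (ler_norm _)).
  apply: (le_trans (abs_ln_sub_le (p _ xy) (p _ x'y))).
  apply: ler_wpM2r; first by rewrite addr_ge0// inv_edist_ge0.
  exact: ler_edist_sub.
rewrite RintegralZl// RintegralD// [leRHS]mulrC; apply: ler_wpM2l; first exact: enorm_ge0.
have := Rintegral_inv_edist_le x (@ltr01 R) bE.
by have := Rintegral_inv_edist_le x' (@ltr01 R) bE; lra.
Qed.

Lemma potential_lipschitz (E : set P) (x x' : P) : bounded_measurable E ->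
  `|potential E x - potential E x'| <= (2 * (4 * pi + area E)) * enorm (psub x x').
Proof.
move=> bE; rewrite ler_norml; apply/andP; split; last exact: potential_sub_le.
by rewrite lerNl opprB psub_enormC; exact: potential_sub_le.
Qed.

Lemma potential_translation (c x : P) r :
  potential (disc c r) (x + c) = potential (disc 0 r) x.
Proof.
rewrite /potential -(disc_translation c).
rewrite -(Rintegral_preserving (measure_preserving_translation c) (measurable_disc c r)
  (measurable_log_edist (x + c))); last first.
  by apply: integrable_log_edist; exact: bounded_measurable_disc.
apply: eq_Rintegral => y _; rewrite /log_edist; congr (ln (enorm _)).
by rewrite /psub/=; congr pair; ring.
Qed.
End LogarithmicPotential.

(** * Potentials of radial sets by averaging over roots of unity *)

Section RadialPotential.
Variable R : realType.
Local Notation P := (R * R)%type.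
Local Notation T := (mplane R).
Local Notation mu := (plane_measure R).
Implicit Types x y z : P.

(* The square of a complex number; [rotation] is complex multiplication. *)
Definition csqr z : P := rotation z z.

Lemma enorm_rotation z y : enorm (rotation z y) = enorm z * enorm y.
Proof.
rewrite /enorm -sqrtrM ?addr_ge0 ?sqr_ge0//; congr Num.sqrt.
by rewrite /rotation/=; ring.
Qed.

Lemma csqr_rotation z y : csqr (rotation z y) = rotation (csqr z) (csqr y).
Proof. by rewrite /csqr /rotation/=; congr pair; ring. Qed.

Lemma iter_csqr_rotation m z y :
  iter m csqr (rotation z y) = rotation (iter m csqr z) (iter m csqr y).
Proof. by elim: m => //= m ->; rewrite csqr_rotation. Qed.

Lemma enorm_iter_csqr m z : enorm (iter m csqr z) = enorm z ^+ (2 ^ m).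
Proof.
elim: m => [|m IH]; first by rewrite expr1.
by rewrite iterS /csqr enorm_rotation IH -expr2 -exprM expnSr.
Qed.

Definition unit_angle (t : R) : P := (cos t, sin t).

Lemma iter_csqr_angle m (t : R) : iter m csqr (unit_angle t) = unit_angle (t *+ 2 ^ m).
Proof.
elim: m => [|m IH]; first by rewrite mulr1n.
rewrite iterS IH /csqr /rotation /unit_angle/= expnSr mulrnA cos_mulr2n sin_mulr2n.
move: (sin2cos2 (t *+ 2 ^ m)); move: (cos _) (sin _) => a b h.
by congr pair; [rewrite -!expr2 h|]; ring.
Qed.

(** A 2^m-th root of -1: rotating y by it changes the sign of y^(2^m). *)
Definition half_turn_root m : P := unit_angle (pi / (2 ^ m)%:R).

Lemma iter_csqr_half_turn_root m y :
  iter m csqr (rotation (half_turn_root m) y) = - iter m csqr y.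
Proof.
rewrite iter_csqr_rotation /half_turn_root iter_csqr_angle.
rewrite -[_ / _ *+ _]mulr_natr divfK ?pnatr_eq0 ?expn_eq0//.
by rewrite /rotation /unit_angle/= cospi sinpi; congr pair; ring.
Qed.

Lemma half_turn_root_unit m : (half_turn_root m).1 ^+ 2 + (half_turn_root m).2 ^+ 2 = 1.
Proof. exact: cos2Dsin2. Qed.

Lemma measurable_iter_csqr m : measurable_fun [set: T] (iter m csqr : T -> T).
Proof.
elim: m => [|m IH]; first exact: measurable_id.
have mc : measurable_fun [set: T] (csqr : T -> T).
  by apply: measurable_fun_pair; [apply: measurable_funB|apply: measurable_funD];
    apply: measurable_funM.
exact: measurableT_comp mc IH.
Qed.

Definition radial (A : set P) := forall y y', enorm y = enorm y' -> A y -> A y'.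

Lemma radial_rotation (A : set P) z : radial A -> z.1 ^+ 2 + z.2 ^+ 2 = 1 ->
  rotation z @^-1` A = A.
Proof.
move=> rA z1; have e y : enorm (rotation z y) = enorm y.
  by rewrite enorm_rotation {1}/enorm z1 sqrtr1 mul1r.
by apply/seteqP; split => y /= Ay; apply: rA Ay; rewrite e.
Qed.

(** With N = 2^m this is log |x^N - y^N|, which for |x| <> |y| is the sum of log |x - z y| over the
    N-th roots of unity z. *)
Definition log_csqr m x y : R := log_edist (iter m csqr x) (iter m csqr y).

Lemma measurable_log_csqr m x : measurable_fun [set: T] (log_csqr m x).
Proof.
by apply: measurableT_comp; [exact: measurable_log_edist|exact: measurable_iter_csqr].
Qed.

(* [x^2 - y^2 = (x - y) (x + y)], applied to the [2^m]-th powers. *)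
Lemma log_csqrS m x y : enorm y <> enorm x ->
  log_csqr m.+1 x y = log_csqr m x y + log_csqr m x (rotation (half_turn_root m) y).
Proof.
move=> yx; rewrite /log_csqr iter_csqr_half_turn_root !iterS.
move: (iter m csqr x) (iter m csqr y) (enorm_iter_csqr m x) (enorm_iter_csqr m y) => X Y eX eY.
have XY : enorm X <> enorm Y.
  rewrite eX eY => /eqP; rewrite eqrXn2 ?expn_gt0 ?enorm_ge0// => /eqP.
  by move=> /esym.
have p1 : 0 < enorm (psub X Y).
  by rewrite lt_neqAle enorm_ge0 andbT eq_sym; apply/eqP => /edist0_eq e; apply: XY; rewrite e.
have p2 : 0 < enorm (psub X (- Y)).
  rewrite lt_neqAle enorm_ge0 andbT eq_sym; apply/eqP => /edist0_eq e; apply: XY.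
  by rewrite e enormN.
rewrite /log_edist -lnM ?posrE//; congr ln; rewrite -enorm_rotation; congr enorm.
by rewrite /csqr /rotation /psub/=; congr pair; ring.
Qed.

(** Induction on [m]: the two terms given by [log_csqrS] differ by a rotation of [y], which
    preserves both area and the radial set [A], so their integrals agree and the integral
    doubles. *)
Lemma log_csqr_average (A : set P) x m : bounded_measurable A -> radial A ->
  (forall y, A y -> enorm y <> enorm x) ->
  mu.-integrable A (EFin \o log_csqr m x) /\
  \int[mu]_(y in A) log_csqr m x y = 2 ^+ m * potential A x.
Proof.
move=> bA rA nA; have mA := bA.1; elim: m => [|m [im IH]].
  by rewrite expr0 mul1r; split => //; exact: integrable_log_edist.
have mpr := measure_preserving_rotation (half_turn_root_unit m).
have := integrable_preserving mpr mA (measurable_log_csqr m x) im.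
have := Rintegral_preserving mpr mA (measurable_log_csqr m x) im.
rewrite (radial_rotation rA (half_turn_root_unit m)) => E ir.
have e : {in A, forall y, log_csqr m x y + log_csqr m x (rotation (half_turn_root m) y)
    = log_csqr m.+1 x y}.
  by move=> y /set_mem/nA h; rewrite log_csqrS.
split.
  have := integrableD_EFin mA im ir; apply: eq_integrable => //.
  by move=> y Ay /=; rewrite e.
transitivity (\int[mu]_(y in A)
  (log_csqr m x y + log_csqr m x (rotation (half_turn_root m) y))).
  by apply: eq_Rintegral => y Ay; rewrite e.
by rewrite RintegralD// E IH exprS; move: (potential A x) (2 ^+ m) => v w; ring.
Qed.

(** For |x| = r > 0, the mean of log |x - y| over the rotations of [y]. *)
Definition log_max (r : R) y : R := ln (Num.max r (enorm y)).

Lemma measurable_log_max r : measurable_fun [set: T] (log_max r).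
Proof.
apply: measurableT_comp; first exact: measurable_ln.
by apply: measurable_maxr => //; exact: measurable_enorm.
Qed.

Lemma log_max_bound (A : set P) r : bounded_measurable A -> 0 < r ->
  exists C : R, forall y, A y -> `|log_max r y| <= C.
Proof.
move=> bA r0; have [M M0 AM] := bounded_measurable_radius bA 0.
exists (Num.max r M + r^-1) => y Ay.
have m0 : 0 < Num.max r (enorm y) by rewrite lt_max r0.
apply: (le_trans (abs_ln_le (ltW m0))); apply: lerD.
  have := AM _ Ay; rewrite psub_enormC [enorm _](_ : _ = enorm y); last by rewrite psubE subr0.
  by move=> yM; rewrite ge_max !le_max lexx yM orbT.
by rewrite lef_pV2// le_max lexx.
Qed.

Lemma integrable_log_max (A : set P) r : bounded_measurable A -> 0 < r ->
  mu.-integrable A (EFin \o log_max r).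
Proof.
move=> bA r0; have [C AC] := log_max_bound bA r0.
exact: (bounded_integrable bA (measurable_log_max r) AC).
Qed.

Lemma ln_half_range (s D B : R) : 0 < s < 1 -> 0 < B -> B * (1 - s) <= D -> D <= B * 2 ->
  `|ln D - ln B| <= ln 2 - ln (1 - s).
Proof.
move=> /andP[s0 s1] B0 h1 h2; have s1' : 0 < 1 - s by rewrite subr_gt0.
have D0 : 0 < D by apply: lt_le_trans h1; exact: mulr_gt0.
have l2 : 0 <= ln 2 :> R by apply: ln_ge0; rewrite ler1n.
have ls : ln (1 - s) <= 0 by apply: ln_le0; rewrite gerBl ltW.
have k1 : ln B + ln (1 - s) <= ln D by rewrite -lnM ?posrE// ler_ln ?posrE ?mulr_gt0.
have k2 : ln D <= ln B + ln 2 by rewrite -lnM ?posrE// ler_ln ?posrE ?mulr_gt0.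
by rewrite ler_norml; apply/andP; split; lra.
Qed.

(** With b the larger norm and N = 2^m, the distance |x^N - y^N| lies between (1 - s) b^N and 2 b^N.
    The bound does not depend on [m], which is what makes the average converge. *)
Lemma log_csqr_approx m x y s : 0 < s < 1 -> 0 < enorm x ->
  Num.min (enorm x) (enorm y) <= s * Num.max (enorm x) (enorm y) ->
  `|log_csqr m x y - 2 ^+ m * log_max (enorm x) y| <= ln 2 - ln (1 - s).
Proof.
move=> /andP[s0 s1] x0 h.
set a := Num.min _ _ in h; set b := Num.max _ _ in h.
have b0 : 0 < b by rewrite lt_max x0.
have a0 : 0 <= a by rewrite le_min !enorm_ge0.
set N := (2 ^ m)%N; have N0 : (0 < N)%N by rewrite expn_gt0.
have -> : 2 ^+ m * log_max (enorm x) y = ln (b ^+ N).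
  by rewrite lnXn// -[ln b *+ _]mulr_natl /N natrX.
have aN : a ^+ N <= b ^+ N * s.
  apply: (@le_trans _ _ ((s * b) ^+ N)).
    by rewrite lerXn2r// nnegrE// mulr_ge0// ltW.
  rewrite exprMn mulrC ler_pM2l ?exprn_gt0//.
  rewrite -[leRHS]expr1; apply: ler_wiXn2l => //; exact: ltW.
rewrite /log_csqr /log_edist.
have eX := enorm_iter_csqr m x; have eY := enorm_iter_csqr m y.
move: (iter m csqr x) (iter m csqr y) eX eY => X Y eX eY.
have hX : enorm X + enorm Y = a ^+ N + b ^+ N.
  by rewrite eX eY /a /b; case: leP => _ //; rewrite addrC.
have hXY : `|enorm X - enorm Y| = b ^+ N - a ^+ N.
  rewrite eX eY /a /b; case: leP => xy.
    rewrite distrC ger0_norm// subr_ge0 lerXn2r// nnegrE ?enorm_ge0//.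
  by rewrite ger0_norm// subr_ge0 lerXn2r// ?nnegrE ?enorm_ge0// ltW.
have bN : 0 < b ^+ N by rewrite exprn_gt0.
apply: ln_half_range; rewrite ?s0 ?s1//.
  apply: (@le_trans _ _ `|enorm X - enorm Y|); first by rewrite hXY mulrBr mulr1; lra.
  have := ler_edist_sub X 0 Y.
  by rewrite (_ : psub X 0 = X) 1?(_ : psub Y 0 = Y)//; rewrite psubE subr0.
apply: (@le_trans _ _ (enorm X + enorm Y)).
  by rewrite psubE -(enormN Y) ler_enormD.
by rewrite hX mulr_natr mulr2n lerD2r; apply: (le_trans aN); rewrite ler_piMr// ltW.
Qed.

(** By averaging, 2^m times the difference of the two sides is bounded uniformly in m, so the
    difference is 0. *)
Lemma radial_potential_gap (A : set P) x (eta : R) : bounded_measurable A -> radial A ->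
  0 < enorm x -> 0 < eta ->
  (forall y, A y -> enorm y <= enorm x - eta \/ enorm x + eta <= enorm y) ->
  potential A x = \int[mu]_(y in A) log_max (enorm x) y.
Proof.
move=> bA rA x0 eta0 gA; have mA := bA.1.
(* This ratio serves on both sides of the gap, since (r - eta)(r + eta) <= r^2. *)
set r := enorm x in x0 gA *; pose s := r / (r + eta).
have re0 : 0 < r + eta by rewrite addr_gt0.
have s01 : 0 < s < 1 by rewrite divr_gt0//= ltr_pdivrMr// mul1r ltrDl.
have gs y : A y -> Num.min r (enorm y) <= s * Num.max r (enorm y).
  move=> /gA[yr|yr].
    have yr' : enorm y <= r by lra.
    rewrite (min_idPr yr') (max_idPl yr') /s mulrAC ler_pdivlMr//.
    by apply: (@le_trans _ _ ((r - eta) * (r + eta))); [rewrite ler_pM2r|nra].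
  have yr' : r <= enorm y by lra.
  by rewrite (min_idPl yr') (max_idPr yr') /s mulrAC ler_pdivlMr// ler_pM2l.
have nA y : A y -> enorm y <> r by move=> /gA[] h e; lra.
set K := ln 2 - ln (1 - s).
have il := integrable_log_max bA x0.
have bound m : 2 ^+ m * `|potential A x - \int[mu]_(y in A) log_max r y| <= K * area A.
  have [im E] := log_csqr_average m bA rA nA.
  have p2 : 0 <= 2 ^+ m :> R by rewrite exprn_ge0.
  rewrite -{1}(ger0_norm p2) -normrM mulrBr -E -RintegralZl//.
  have i2 := integrableZ_EFin (2 ^+ m) mA il.
  rewrite -RintegralB//.
  have i3 := integrableB_EFin mA im i2.
  apply: (le_trans (le_normr_Rintegral mA i3)).
  rewrite -Rintegral_cst_area//; apply: le_Rintegral => //.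
  - exact: (integrable_norm i3).
  - exact: integrable_cst.
  - by move=> y Ay; exact: log_csqr_approx (gs _ Ay).
apply/eqP; rewrite -subr_eq0 -normr_le0 leNgt; apply/negP.
set u := `|_|; move=> u0.
have K0 : 0 <= K * area A by apply: le_trans (bound 0%N); rewrite mulr_ge0// ltW.
pose n := (Num.truncn (K * area A / u)).+1.
have := bound n; apply/negP; rewrite -ltNge.
apply: (@lt_le_trans _ _ (n%:R * u)); first by rewrite -ltr_pdivrMr// truncnS_gt.
by rewrite ler_pM2r// -natrX ler_nat ltnW// ltn_expl.
Qed.

Lemma enorm_disc0 y r : disc 0 r y <-> enorm y < r.
Proof. by rewrite /disc/= psubE subr0. Qed.

Lemma radial_disc r : radial (disc 0 r).
Proof. by move=> y y' e /enorm_disc0 h; apply/enorm_disc0; rewrite -e. Qed.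

(* Newton's theorem for a disc: the thin annulus around the circle through [x] is
   handled by the bound on the integral of [1 / |x - y|]. *)
Lemma potential_disc_log_max x (rho : R) : 0 < enorm x ->
  potential (disc 0 rho) x = \int[mu]_(y in disc 0 rho) log_max (enorm x) y.
Proof.
move=> x0; set B := disc 0 rho; have bB : bounded_measurable B := bounded_measurable_disc 0 rho.
set r := enorm x in x0 *.
have [C' BC'] := log_max_bound bB x0; pose C : R := `|C'|.
have C0 : 0 <= C := normr_ge0 _.
have BC y : B y -> `|log_max r y| <= C by move=> /BC' h; apply: (le_trans h); exact: ler_norm.
have [M M0 BM] := bounded_measurable_radius bB x.
(* The annulus of radii r - eta and r + eta has area 4 pi r eta. Off it the two sides agree; on it
   the integrands are bounded by C and by M + 1 / |x - y|. *)
have ub (eta d : R) : 0 < eta < r -> 0 < d ->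
    `|potential B x - \int[mu]_(y in B) log_max r y|
      <= (C + M) * (4 * pi * r * eta) + (4 * pi * d + 4 * pi * r * eta / d).
  move=> /andP[eta0 etar] d0.
  have re : 0 < r - eta by rewrite subr_gt0.
  have rp : 0 < r + eta by rewrite addr_gt0.
  pose N : set P := disc 0 (r + eta) `\` disc 0 (r - eta).
  have mN : measurable (N : set T) by apply: measurableD; exact: measurable_disc.
  have bN : bounded_measurable N.
    by apply: bounded_measurableS (bounded_measurable_disc 0 (r + eta)) mN _; exact: subDsetl.
  have aN : area N = 4 * pi * r * eta.
    have := area_setU bN (bounded_measurable_disc 0 (r - eta)).
    rewrite (_ : N `|` disc 0 (r - eta) = disc 0 (r + eta)).
      rewrite !area_disc// => /(_ _)/eqP; rewrite -subr_eq => h; apply/esym.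
      apply: etrans (eqP (h _)); first ring.
      by apply/seteqP; split => // y [[]].
    apply/seteqP; split => [y [[]//|/enorm_disc0 h]|y h].
      by apply/enorm_disc0; lra.
    by have [k|k] := pselect (disc 0 (r - eta) y); [right|left].
  pose B1 := B `\` N; pose B2 := B `&` N.
  have BB : B = B1 `|` B2 by rewrite setUC /B1 /B2 setUIDK.
  have bB1 : bounded_measurable B1.
    by apply: (bounded_measurableS bB); [apply: measurableD => //; exact: bB.1|exact: subDsetl].
  have bB2 : bounded_measurable B2.
    by apply: (bounded_measurableS bB); [apply: measurableI => //; exact: bB.1|exact: subIsetl].
  have B12 : B1 `&` B2 = set0 by apply/seteqP; split => // y [[_ n] [_ /n]].
  have rB1 : radial B1.
    move=> y y' e [/(radial_disc e) h n]; split => // -[k1 k2]; apply: n.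
    by split; [exact: radial_disc (esym e) k1|move=> k; apply: k2; exact: radial_disc e k].
  have g1 : potential B1 x = \int[mu]_(y in B1) log_max r y.
    apply: (radial_potential_gap bB1 rB1 x0 eta0) => y [By nN].
    have [k|k] := leP (enorm y) (r - eta); first by left.
    right; rewrite leNgt; apply/negP => k'; apply: nN; split.
      exact/enorm_disc0.
    by move/enorm_disc0; rewrite ltNge (ltW k).
  rewrite {1}BB (potential_setU _ bB1 bB2 B12) [X in Rintegral _ X _]BB Rintegral_setU//; last 4 first.
  - exact: bB1.1.
  - exact: bB2.1.
  - by rewrite -BB; exact: integrable_log_max.
  - by rewrite disj_set2E B12 eqxx.
  rewrite g1 opprD addrACA subrr add0r -RintegralB//; last 3 first.
  - exact: bB2.1.
  - exact: integrable_log_edist.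
  - exact: integrable_log_max.
  have mB2 := bB2.1.
  have i3 := integrableB_EFin mB2 (integrable_log_edist x bB2) (integrable_log_max bB2 x0).
  apply: (le_trans (le_normr_Rintegral mB2 i3)).
  have ic := integrable_cst (C + M) bB2; have ii := integrable_inv_edist x bB2.
  apply: (@le_trans _ _ (\int[mu]_(y in B2) ((C + M) + inv_edist x y))).
    apply: le_Rintegral => //.
    - exact: (integrable_norm i3).
    - exact: integrableD_EFin.
    - move=> y [By _]; apply: (le_trans (ler_normB _ _)).
      have := BC _ By; have := BM _ By.
      by have := abs_ln_le (enorm_ge0 (psub x y)); rewrite /log_edist /inv_edist; lra.
  rewrite RintegralD// Rintegral_cst_area//.
  have a2 : area B2 <= 4 * pi * r * eta by rewrite -aN; apply: le_area => //; exact: subIsetr.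
  apply: lerD; first by rewrite ler_wpM2l// addr_ge0// ltW.
  apply: (le_trans (Rintegral_inv_edist_le x d0 bB2)).
  by rewrite lerD2l ler_pM2r// invr_gt0.
apply/eqP; rewrite -subr_eq0 -normr_le0; apply/ler_addgt0Pr => e e0; rewrite add0r.
have pi0 : 0 < pi :> R := pi_gt0 R.
(* [d] is fixed first, to make 4 pi d equal to e / 4; [eta] is chosen afterwards, since the
   remaining terms contain eta / d. *)
pose d := e / (16 * pi).
have d0 : 0 < d by rewrite divr_gt0// mulr_gt0.
pose K := 4 * pi * r * ((C + M) + d^-1).
have K0 : 0 < K by rewrite !mulr_gt0// ltr_wpDl ?invr_gt0// addr_ge0// ltW.
pose eta := Num.min (r / 2) (e / (2 * K)).
have eta0 : 0 < eta by rewrite lt_min !divr_gt0// mulr_gt0.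
have etar : eta < r by rewrite gt_min ltr_pdivrMr// ltr_pMr// ltr1n.
apply: (le_trans (ub eta d _ d0)); first by rewrite eta0.
have -> : (C + M) * (4 * pi * r * eta) + (4 * pi * d + 4 * pi * r * eta / d)
   = K * eta + 4 * pi * d by rewrite /K; ring.
have dE : d * (16 * pi) = e by rewrite /d divfK// lt0r_neq0// mulr_gt0.
have -> : 4 * pi * d = e / 4 by rewrite -dE; field.
have : K * eta <= e / 2.
  apply: (@le_trans _ _ (K * (e / (2 * K)))); first by rewrite ler_pM2l// ge_min lexx orbT.
  by rewrite le_eqVlt; apply/orP; left; apply/eqP; field; rewrite gt_eqF.
lra.
Qed.
End RadialPotential.

(** * Growth of the potential of a disc *)

Section DiscPotential.
Variable R : realType.
Local Notation P := (R * R)%type.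
Local Notation T := (mplane R).
Local Notation mu := (plane_measure R).
Implicit Types x y z : P.

(** The integrand on the right vanishes for |y| >= |x|, equals log (|x| / |x'|) for |y| <= |x'|, and
    lies between these values otherwise. Comparison with multiples of indicators of discs then
    bounds the difference from both sides. *)
Lemma potential_disc_sub x x' (rho : R) : 0 < enorm x' -> enorm x' < enorm x ->
  potential (disc 0 rho) x - potential (disc 0 rho) x' =
  \int[mu]_(y in disc 0 rho) (log_max (enorm x) y - log_max (enorm x') y).
Proof.
move=> x'0 xx'; have x0 := lt_trans x'0 xx'.
have bB := bounded_measurable_disc (0 : P) rho.
rewrite !potential_disc_log_max// RintegralB//; first exact: bB.1.
- exact: integrable_log_max.
- exact: integrable_log_max.
Qed.

Lemma Rintegral_indicM (E A : set P) (c : R) : bounded_measurable E ->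
  measurable (A : set T) -> A `<=` E ->
  mu.-integrable E (EFin \o (fun y => c * \1_A y)) /\
  \int[mu]_(y in E) (c * \1_A y) = c * area A.
Proof.
move=> bE mA AE; have mE := bE.1.
have mi : measurable_fun [set: T] (\1_A : T -> R) by exact: measurable_indic.
have ii : mu.-integrable E (EFin \o (\1_A : P -> R)).
  apply: (@bounded_integrable _ _ _ 1) => // y _.
  by rewrite indicE; case: (_ \in _); rewrite ?normr1 ?normr0.
split; first exact: integrableZ_EFin.
rewrite RintegralZl//; congr (_ * _).
by rewrite /Rintegral integral_indic// (setIidl AE).
Qed.

Lemma log_max_sub_ge0 (r r' : R) y : 0 < r' -> r' < r -> 0 <= log_max r y - log_max r' y.
Proof.
move=> r'0 r'r; have r0 := lt_trans r'0 r'r.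
have m1 : 0 < Num.max r' (enorm y) by rewrite lt_max r'0.
have m2 : 0 < Num.max r (enorm y) by rewrite lt_max r0.
rewrite subr_ge0 ler_ln ?posrE//.
by rewrite ge_max !le_max lexx (ltW r'r) !orbT.
Qed.

Lemma potential_disc_sub_le x x' (rho : R) : 0 < enorm x' -> enorm x' < enorm x ->
  enorm x <= rho ->
  potential (disc 0 rho) x - potential (disc 0 rho) x'
    <= pi * enorm x ^+ 2 * ln (enorm x / enorm x').
Proof.
move=> x'0 xx' xr; have x0 := lt_trans x'0 xx'.
have bB := bounded_measurable_disc (0 : P) rho.
rewrite potential_disc_sub//; set r := enorm x in x0 xx' xr *; set r' := enorm x' in x'0 xx' *.
have BA : disc 0 r `<=` disc (0 : P) rho.
  by move=> y /enorm_disc0 h; apply/enorm_disc0; exact: lt_le_trans xr.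
have [i1 e1] := Rintegral_indicM (ln (r / r')) bB (measurable_disc 0 r) BA.
rewrite mulrC -(area_disc 0 x0) -e1; apply: le_Rintegral => //; first exact: bB.1.
  by apply: integrableB_EFin; [exact: bB.1|exact: integrable_log_max|exact: integrable_log_max].
move=> y _; rewrite indicE; have [h|h] := ltP (enorm y) r.
  rewrite mem_set; last exact/enorm_disc0.
  rewrite mulr1 ln_div ?posrE// /log_max (max_idPl (ltW h)) lerD2l lerN2.
  by rewrite ler_ln ?posrE ?lt_max ?x'0// le_max lexx.
rewrite memNset; last by move/enorm_disc0; rewrite ltNge h.
by rewrite mulr0 /log_max (max_idPr h) max_r ?subrr//; exact: le_trans (ltW xx') h.
Qed.

Lemma potential_disc_sub_ge x x' (rho : R) : 0 < enorm x' -> enorm x' < enorm x ->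
  enorm x <= rho ->
  pi * enorm x' ^+ 2 * ln (enorm x / enorm x')
    <= potential (disc 0 rho) x - potential (disc 0 rho) x'.
Proof.
move=> x'0 xx' xr; have x0 := lt_trans x'0 xx'.
have bB := bounded_measurable_disc (0 : P) rho.
rewrite potential_disc_sub//; set r := enorm x in x0 xx' xr *; set r' := enorm x' in x'0 xx' *.
have BA : disc 0 r' `<=` disc (0 : P) rho.
  move=> y /enorm_disc0 h; apply/enorm_disc0; apply: lt_le_trans h _.
  exact: le_trans (ltW xx') xr.
have [i1 e1] := Rintegral_indicM (ln (r / r')) bB (measurable_disc 0 r') BA.
rewrite mulrC -(area_disc 0 x'0) -e1; apply: le_Rintegral => //; first exact: bB.1.
  by apply: integrableB_EFin; [exact: bB.1|exact: integrable_log_max|exact: integrable_log_max].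
move=> y _; rewrite indicE; have [h|h] := ltP (enorm y) r'.
  rewrite mem_set; last exact/enorm_disc0.
  rewrite mulr1 ln_div ?posrE// /log_max (max_idPl (ltW h)) max_l//.
  by apply: ltW; exact: lt_trans h xx'.
rewrite memNset; last by move/enorm_disc0; rewrite ltNge h.
by rewrite mulr0; exact: log_max_sub_ge0.
Qed.

Lemma enormZ (t : R) x : enorm (t * x.1, t * x.2) = `|t| * enorm x.
Proof.
rewrite /enorm -sqrtr_sqr -sqrtrM ?sqr_ge0//; congr Num.sqrt => /=; ring.
Qed.

Lemma ln_inv_ge (q : R) : 0 < q -> 1 - q <= ln q^-1.
Proof.
move=> q0; have : ln (1 + (q - 1)) <= q - 1 by apply: le_ln1Dx; lra.
by rewrite addrC subrK lnV ?posrE//; lra.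
Qed.

(* Telescoping the previous estimate along [x, q x, q^2 x, ...] and then letting [q]
   tend to [1]: the geometric series sums to [q^2 / (1 + q)], which tends to [1/2]. *)
Lemma potential_disc_ge x (rho : R) : enorm x <= rho ->
  potential (disc 0 rho) 0 + pi / 2 * enorm x ^+ 2 <= potential (disc 0 rho) x.
Proof.
move=> xr; have := enorm_ge0 x; rewrite le_eqVlt => /orP[/eqP x0|x0].
  by rewrite -x0 expr0n mulr0 addr0 (enorm0_eq0 (esym x0)).
have bB := bounded_measurable_disc (0 : P) rho.
set V := potential (disc 0 rho); set r := enorm x in x0 xr *.
have pi0 : 0 < pi :> R := pi_gt0 R.
pose pt (t : R) : P := (t * x.1, t * x.2).
have ept t : 0 <= t -> enorm (pt t) = t * r by move=> t0; rewrite enormZ ger0_norm.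
have step q n : 0 < q -> q < 1 ->
    pi * r ^+ 2 * (q ^+ 2 / (1 + q)) * (1 - q ^+ (2 * n)) <= V x - V (pt (q ^+ n)).
  move=> q0 q1; elim: n => [|n IH].
    rewrite muln0 !expr0 subrr mulr0 (_ : pt 1 = x) ?subrr//.
    by rewrite /pt !mul1r -surjective_pairing.
  have qn0 : 0 < q ^+ n by rewrite exprn_gt0.
  have e1 := ept _ (ltW qn0); have e2 := ept (q ^+ n.+1) (exprn_ge0 _ (ltW q0)).
  have p2 : 0 < enorm (pt (q ^+ n.+1)) by rewrite e2 mulr_gt0// exprn_gt0.
  have lt21 : enorm (pt (q ^+ n.+1)) < enorm (pt (q ^+ n)).
    by rewrite e1 e2 ltr_pM2r// exprS gtr_pMl.
  have p1r : enorm (pt (q ^+ n)) <= rho.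
    by rewrite e1; apply: le_trans xr; rewrite ler_piMl ?(ltW x0)// exprn_ile1// ltW.
  have := potential_disc_sub_ge p2 lt21 p1r; rewrite -/V.
  have -> : enorm (pt (q ^+ n)) / enorm (pt (q ^+ n.+1)) = q^-1.
    by rewrite e1 e2 exprS; field; rewrite !gt_eqF.
  have h := ln_inv_ge q0.
  have h' : pi * enorm (pt (q ^+ n.+1)) ^+ 2 * (1 - q)
      <= pi * enorm (pt (q ^+ n.+1)) ^+ 2 * ln q^-1.
    by apply: ler_wpM2l => //; rewrite mulr_ge0 ?sqr_ge0// ltW.
  move=> h2; have {h' h2} h3 := le_trans h' h2.
  have -> : pi * r ^+ 2 * (q ^+ 2 / (1 + q)) * (1 - q ^+ (2 * n.+1)) =
     pi * r ^+ 2 * (q ^+ 2 / (1 + q)) * (1 - q ^+ (2 * n)) +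
     pi * enorm (pt (q ^+ n.+1)) ^+ 2 * (1 - q).
    have E1 : q ^+ (2 * n) = q ^+ n * q ^+ n by rewrite mulnC exprM expr2.
    have E2 : q ^+ (2 * n.+1) = q * q * (q ^+ n * q ^+ n).
      by rewrite mulnS exprD E1 expr2.
    rewrite e2 E1 E2 (exprS q n); move: (q ^+ n) => Q.
    by field; rewrite gt_eqF// addr_gt0.
  rewrite -[leRHS](subrKA (V (pt (q ^+ n)))).
  exact: lerD IH h3.
(* The points [pt (q ^+ n)] tend to the centre, which the formula with [log_max] does not reach;
   Lipschitz continuity of the potential passes to the limit. *)
have lim0 q : 0 < q -> q < 1 -> pi * r ^+ 2 * (q ^+ 2 / (1 + q)) <= V x - V 0.
  move=> q0 q1; set A := pi * r ^+ 2 * _.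
  pose L := 2 * (4 * pi + area (disc (0 : P) rho)).
  have L0 : 0 <= L by rewrite mulr_ge0// addr_ge0 ?area_ge0// mulr_ge0// ltW.
  have A0 : 0 <= A.
    apply: mulr_ge0; first by rewrite mulr_ge0 ?sqr_ge0// ltW.
    by apply: divr_ge0; [exact: sqr_ge0|rewrite addr_ge0// ltW].
  apply/ler_addgt0Pr => e e0.
  have [n hn] : exists n, (A + L * r) * q ^+ n <= e.
    have q1' : `|q| < 1 by rewrite gtr0_norm.
    have W0 : 0 < A + L * r + 1 by rewrite ltr_wpDl// addr_ge0// mulr_ge0// ltW.
    have := cvg_expr q1' => /cvgrPdist_lt /(_ (e / (A + L * r + 1))).
    case; first by rewrite divr_gt0.
    move=> n _ /(_ n (leqnn n)); rewrite /= sub0r normrN ger0_norm ?exprn_ge0 ?ltW//.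
    rewrite ltr_pdivlMr// => h; exists n; rewrite mulrC; apply: le_trans (ltW h).
    by rewrite ler_wpM2l ?exprn_ge0 ?(ltW q0)// lerDl.
  have := step q n q0 q1; rewrite -/A.
  have := potential_lipschitz (pt (q ^+ n)) 0 bB; rewrite -/V -/L.
  rewrite psubE subr0 ept ?exprn_ge0 ?(ltW q0)//.
  rewrite ler_norml => /andP[h1 _] h2.
  have q2 : q ^+ (2 * n) <= q ^+ n.
    by apply: ler_wiXn2l; rewrite ?(ltW q0) ?(ltW q1)// leq_pmull.
  have : A * q ^+ (2 * n) <= A * q ^+ n by exact: ler_wpM2l.
  nra.
rewrite -lerBrDl; apply/ler_addgt0Pr => e e0.
pose W := pi * r ^+ 2; have W0 : 0 < W by rewrite mulr_gt0// exprn_gt0.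
pose a := Num.min (1 / 2) (e / (2 * W)).
have a0 : 0 < a by rewrite lt_min !divr_gt0// mulr_gt0.
have a12 : a <= 1 / 2 by rewrite ge_min lexx.
have aW : W * a <= e / 2.
  apply: (@le_trans _ _ (W * (e / (2 * W)))); first by rewrite ler_pM2l// ge_min lexx orbT.
  by rewrite le_eqVlt; apply/orP; left; apply/eqP; field; rewrite gt_eqF.
have := lim0 (1 - a); rewrite -/W => /(_ _ _) h.
have {h} h : W * ((1 - a) ^+ 2 / (1 + (1 - a))) <= V x - V 0 by apply: h; lra.
have k : 1 / 2 - a <= (1 - a) ^+ 2 / (1 + (1 - a)).
  by rewrite ler_pdivlMr; [nra|lra].
have : W * (1 / 2 - a) <= W * ((1 - a) ^+ 2 / (1 + (1 - a))) by rewrite ler_pM2l.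
have -> : pi / 2 * r ^+ 2 = W / 2 by rewrite /W; ring.
lra.
Qed.

Lemma potential_disc_center_ge (c x : P) (rho : R) : enorm (psub x c) <= rho ->
  potential (disc c rho) c + pi / 2 * enorm (psub x c) ^+ 2 <= potential (disc c rho) x.
Proof.
move=> xr; have := potential_disc_ge xr; rewrite -!(potential_translation c) add0r.
by rewrite psubE subrK.
Qed.
End DiscPotential.

(** * Euclidean discs and the product topology *)

Section PlaneTopology.
Variable R : realType.
Local Notation P := (R * R)%type.
Implicit Types (x y p : P) (D : set P).

Lemma ler_enorm_l1 x : enorm x <= `|x.1| + `|x.2|.
Proof.
rewrite -(ler_pXn2r (n := 2))// ?nnegrE ?addr_ge0 ?enorm_ge0//.
rewrite sqr_enorm sqrrD !real_normK ?num_real//.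
have : 0 <= `|x.1| * `|x.2| by rewrite mulr_ge0.
by rewrite mulr2n; lra.
Qed.

Lemma ler_coord1_enorm x : `|x.1| <= enorm x.
Proof.
rewrite -(ler_pXn2r (n := 2))// ?nnegrE ?enorm_ge0//.
by rewrite sqr_enorm real_normK ?num_real// lerDl sqr_ge0.
Qed.

Lemma ler_coord2_enorm x : `|x.2| <= enorm x.
Proof.
rewrite -(ler_pXn2r (n := 2))// ?nnegrE ?enorm_ge0//.
by rewrite sqr_enorm real_normK ?num_real// lerDr sqr_ge0.
Qed.

Lemma edist_origin x : enorm (psub x 0) = enorm x.
Proof. by rewrite psubE subr0. Qed.

Lemma ler_enorm_edist x y : enorm x <= enorm y + enorm (psub y x).
Proof.
by have := edist_triangle x y 0; rewrite !edist_origin (psub_enormC x y); lra.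
Qed.

Lemma disc_nbhs x (r : R) : 0 < r -> nbhs x (disc x r).
Proof.
move=> r0; apply/nbhs_ballP; exists (r / 2); first by rewrite /= divr_gt0.
move=> y [y1 y2]; rewrite /disc/= psub_enormC; apply: (le_lt_trans (ler_enorm_l1 _)).
by rewrite [ltRHS]splitr; apply: ltrD; rewrite /psub/=; [move: y1|move: y2]; rewrite /ball/=.
Qed.

Lemma nbhs_disc x D : nbhs x D -> exists2 r : R, 0 < r & disc x r `<=` D.
Proof.
move=> /nbhs_ballP[r /= r0 rD]; exists r => // y; rewrite /disc/= psub_enormC => h.
apply: rD; split; rewrite /ball/=.
  exact: le_lt_trans (ler_coord1_enorm (psub x y)) h.
exact: le_lt_trans (ler_coord2_enorm (psub x y)) h.
Qed.

Lemma open_disc_sub D x : open D -> D x -> exists2 r : R, 0 < r & disc x r `<=` D.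
Proof. by move=> oD Dx; apply: nbhs_disc; exact: open_nbhs_nbhs. Qed.

Lemma closure_disc D x : closure D x <->
  forall r : R, 0 < r -> exists2 y, D y & enorm (psub y x) < r.
Proof.
split=> [cD r r0|h B /nbhs_disc[r r0 rB]].
  by have [y [Dy yr]] := cD _ (disc_nbhs x r0); exists y.
by have [y Dy yr] := h _ r0; exists y; split => //; exact: rB.
Qed.

Lemma edist_lipschitz_continuous (f : P -> R) (L : R) : 0 <= L ->
  (forall x y, `|f x - f y| <= L * enorm (psub x y)) -> continuous f.
Proof.
move=> L0 fL x; apply/cvgrPdist_lt => e e0.
have d0 : 0 < e / (L + 1) by rewrite divr_gt0// ltr_wpDl.
have := disc_nbhs x d0; apply: filterS => y; rewrite /disc/= psub_enormC => h.
apply: (le_lt_trans (fL x y)).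
have h' : (L + 1) * enorm (psub x y) < e by rewrite mulrC -ltr_pdivlMr// ltr_wpDl.
apply: le_lt_trans h'; by rewrite ler_wpM2r ?enorm_ge0// lerDl.
Qed.

Lemma continuous_enorm : continuous (@enorm R).
Proof.
apply: (@edist_lipschitz_continuous _ 1) => // x y; rewrite mul1r.
by have := ler_edist_sub x 0 y; rewrite !psubE !subr0.
Qed.

Lemma compact_closure2 D (M : R) : (forall x, D x -> enorm x <= M) -> compact (closure D).
Proof.
move=> DM; have cM := @segment_compact R (- (M + 1)) (M + 1).
apply: (subclosed_compact (B := `[- (M + 1), M + 1] `*` `[- (M + 1), M + 1])).
- exact: closed_closure.
- exact: compact_setX.
- move=> x /closure_disc /(_ 1 ltr01)[y /DM yM xy].
  have xM : enorm x <= M + 1.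
    have := ler_enorm_edist x y; lra.
  split; rewrite /= in_itv/= -ler_norml; apply: le_trans xM;
    [exact: ler_coord1_enorm|exact: ler_coord2_enorm].
Qed.

(** Ensures that a point of the closure farthest from 0 is not in [D], hence is a boundary point.
    The outward push is a dilation of [x], or any small vector when [x] is 0. *)
Lemma open_farther D x : open D -> D x -> exists2 y, D y & enorm x < enorm y.
Proof.
move=> oD Dx; have [r r0 rD] := open_disc_sub oD Dx.
have := enorm_ge0 x; rewrite le_eqVlt => /orP[/eqP/esym x0|x0].
  exists (r / 2, 0).
    apply: rD; rewrite /disc/= (enorm0_eq0 x0) psubE subr0.
    rewrite /enorm/= expr0n addr0 sqrtr_sqr ger0_norm ?divr_ge0 ?ltW//.
    by rewrite ltr_pdivrMr// ltr_pMr// ltr1n.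
  by rewrite x0 /enorm/= expr0n addr0 sqrtr_sqr normr_gt0 gt_eqF// divr_gt0.
pose s := r / (2 * enorm x).
have s0 : 0 < s by rewrite divr_gt0// mulr_gt0.
exists ((1 + s) * x.1, (1 + s) * x.2).
  apply: rD; rewrite /disc/=.
  have -> : psub ((1 + s) * x.1, (1 + s) * x.2) x = (s * x.1, s * x.2).
    by rewrite /psub/=; congr pair; ring.
  rewrite enormZ gtr0_norm// /s invfM mulrA mulfVK ?gt_eqF//.
  by rewrite ltr_pdivrMr// ltr_pMr// ltr1n.
rewrite enormZ ger0_norm ?addr_ge0 ?(ltW s0)// ltr_pMl//; lra.
Qed.
End PlaneTopology.

(** * Discrete Laplacian and the maximum principle *)

Section MaximumPrinciple.
Variable R : realType.
Local Notation P := (R * R)%type.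
Local Notation T := (mplane R).
Local Notation mu := (plane_measure R).
Implicit Types (x y z : P) (D : set P).

(** Subtracting [4 * f x] gives h^2 times the five-point discrete Laplacian of [f]. *)
Definition four_sum (f : P -> R) x (h : R) : R :=
  f (x.1 + h, x.2) + f (x.1 - h, x.2) + f (x.1, x.2 + h) + f (x.1, x.2 - h).

Lemma four_sum_linear (f g : P -> R) (k : R) x (h : R) :
  four_sum (fun z => f z + k * g z) x h = four_sum f x h + k * four_sum g x h.
Proof. by rewrite /four_sum; ring. Qed.

(* With [z = x - y], the four distances multiply to [|z^4 - h^4| >= |z|^4 - h^4]. *)
Lemma log_edist_four_sum x y (r h : R) : 0 < h -> h <= r / 2 -> r <= enorm (psub x y) ->
  4 * log_edist x y - 2 * h ^+ 4 / r ^+ 4 <= four_sum (fun z => log_edist z y) x h.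
Proof.
move=> h0 hr rxy; have r0 : 0 < r by lra.
set a := x.1 - y.1; set b := x.2 - y.2.
have d0 : 0 < enorm (psub x y) by exact: lt_le_trans rxy.
have far z : enorm (psub z x) <= h -> 0 < enorm (psub z y).
  move=> zx; have := edist_triangle x z y; rewrite (psub_enormC x z); lra.
have hh : `|h| = h by rewrite gtr0_norm.
have near1 (t : R) : `|t| = h -> enorm (psub (x.1 + t, x.2) x) <= h.
  move=> <-; apply: (le_trans (ler_enorm_l1 _)); rewrite /psub/= subrr normr0 addr0.
  by rewrite addrC addKr.
have near2 (t : R) : `|t| = h -> enorm (psub (x.1, x.2 + t) x) <= h.
  move=> <-; apply: (le_trans (ler_enorm_l1 _)); rewrite /psub/= subrr normr0 add0r.
  by rewrite addrC addKr.
have hN : `|- h| = h by rewrite normrN.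
have p1 := far _ (near1 _ hh); have p2 := far _ (near1 _ hN).
have p3 := far _ (near2 _ hh); have p4 := far _ (near2 _ hN).
rewrite /four_sum /log_edist -!lnM ?posrE ?mulr_gt0//.
set d1 := enorm (psub (x.1 + h, x.2) y) in p1 *; set d2 := enorm (psub (x.1 - h, x.2) y) in p2 *.
set d3 := enorm (psub (x.1, x.2 + h) y) in p3 *; set d4 := enorm (psub (x.1, x.2 - h) y) in p4 *.
set d := enorm (psub x y) in rxy d0 *.
have e1 : d1 ^+ 2 = (a + h) ^+ 2 + b ^+ 2 by rewrite sqr_enorm /psub/= /a /b; ring.
have e2 : d2 ^+ 2 = (a - h) ^+ 2 + b ^+ 2 by rewrite sqr_enorm /psub/= /a /b; ring.
have e3 : d3 ^+ 2 = a ^+ 2 + (b + h) ^+ 2 by rewrite sqr_enorm /psub/= /a /b; ring.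
have e4 : d4 ^+ 2 = a ^+ 2 + (b - h) ^+ 2 by rewrite sqr_enorm /psub/= /a /b; ring.
have ed : d ^+ 2 = a ^+ 2 + b ^+ 2 by rewrite sqr_enorm.
have d4E : d ^+ 4 = (a ^+ 2 + b ^+ 2) ^+ 2 by rewrite -ed -exprM.
have r4 : 0 < r ^+ 4 by rewrite exprn_gt0.
have rd4 : r ^+ 4 <= d ^+ 4 by rewrite lerXn2r// nnegrE ltW.
have h4 : h ^+ 4 <= r ^+ 4 / 2.
  apply: (@le_trans _ _ ((r / 2) ^+ 4)).
    by rewrite lerXn2r// nnegrE ?divr_ge0// ltW.
  rewrite exprMn ler_pM2l//; lra.
have h40 : 0 < h ^+ 4 by rewrite exprn_gt0.
have prod : d ^+ 4 - h ^+ 4 <= d1 * d2 * d3 * d4.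
  rewrite -(ler_pXn2r (n := 2))// ?nnegrE; [|lra|by rewrite !mulr_ge0// ltW].
  rewrite !exprMn e1 e2 e3 e4 d4E.
  rewrite -subr_ge0.
  have -> : ((a + h) ^+ 2 + b ^+ 2) * ((a - h) ^+ 2 + b ^+ 2) * (a ^+ 2 + (b + h) ^+ 2) *
    (a ^+ 2 + (b - h) ^+ 2) - ((a ^+ 2 + b ^+ 2) ^+ 2 - h ^+ 4) ^+ 2 =
    (4 * h ^+ 2 * a * b) ^+ 2 by ring.
  exact: sqr_ge0.
have q0 : 0 < d ^+ 4 - h ^+ 4 by lra.
apply: (@le_trans _ _ (ln (d ^+ 4 - h ^+ 4))); last first.
  by rewrite ler_ln ?posrE//; exact: lt_le_trans prod.
have -> : 4 * ln d = ln (d ^+ 4) by rewrite lnXn// -[RHS]mulr_natl.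
have d40 : 0 < d ^+ 4 by rewrite exprn_gt0.
(* Replacing d^4 by d^4 - h^4 lowers the logarithm by at most h^4 / (d^4 - h^4), and the denominator
   is at least r^4 / 2 by [h4] and [rd4]. *)
have := ln_sub_le d40 q0; rewrite subKr => l.
have : h ^+ 4 / (d ^+ 4 - h ^+ 4) <= 2 * h ^+ 4 / r ^+ 4.
  rewrite ler_pdivrMr// mulrAC ler_pdivlMr//.
  have : h ^+ 4 * r ^+ 4 <= h ^+ 4 * (2 * (d ^+ 4 - h ^+ 4)) by rewrite ler_pM2l//; lra.
  lra.
lra.
Qed.

Lemma integrable_four_sum D x (h : R) : bounded_measurable D ->
  mu.-integrable D (EFin \o (fun y => four_sum (fun z => log_edist z y) x h)) /\
  \int[mu]_(y in D) four_sum (fun z => log_edist z y) x h = four_sum (potential D) x h.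
Proof.
move=> bD; have mD := bD.1; have i z := integrable_log_edist z bD.
split; first by do 3 apply: integrableD_EFin => //.
rewrite /four_sum RintegralD//; last by do 2 apply: integrableD_EFin => //.
by rewrite RintegralD//; [rewrite RintegralD//|exact: integrableD_EFin].
Qed.

Lemma potential_four_sum_far D x (r h : R) : bounded_measurable D ->
  0 < h -> h <= r / 2 -> (forall y, D y -> r <= enorm (psub x y)) ->
  4 * potential D x - 2 * h ^+ 4 / r ^+ 4 * area D <= four_sum (potential D) x h.
Proof.
move=> bD h0 hr Dr; have mD := bD.1; have i := integrable_log_edist x bD.
have [j <-] := integrable_four_sum x h bD.
have i4 := integrableZ_EFin 4 mD i; have ic := integrable_cst (2 * h ^+ 4 / r ^+ 4) bD.
rewrite -Rintegral_cst_area// -RintegralZl// -RintegralB//.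
apply: le_Rintegral => //; first exact: integrableB_EFin.
by move=> y /Dr; exact: log_edist_four_sum.
Qed.

(** The disc about [x] contributes a gain of at least (pi / 2) h^2 at each of the four points. The
    rest of [D] is at distance at least [r] from [x], where the logarithm is harmonic up to an error
    of order h^4. *)
Lemma potential_four_sum_ge D x (r h : R) : bounded_measurable D -> disc x r `<=` D ->
  0 < h -> h <= r / 2 ->
  4 * potential D x + 2 * pi * h ^+ 2 - 2 * h ^+ 4 / r ^+ 4 * area D
    <= four_sum (potential D) x h.
Proof.
have lin (b f w k1 k2 b1 b2 b3 b4 f1 f2 f3 f4 : R) : b + w <= b1 -> b + w <= b2 ->
    b + w <= b3 -> b + w <= b4 -> 4 * f - k1 <= f1 + f2 + f3 + f4 -> k1 <= k2 ->
    4 * (b + f) + 4 * w - k2 <= b1 + f1 + (b2 + f2) + (b3 + f3) + (b4 + f4) by lra.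
move=> bD rD h0 hr; have r0 : 0 < r by lra.
have bB := bounded_measurable_disc x r; pose F := D `\` disc x r.
have bF : bounded_measurable F.
  apply: (bounded_measurableS bD); last exact: subDsetl.
  by apply: measurableD; [exact: bD.1|exact: measurable_disc].
have BF : disc x r `&` F = set0 by apply/seteqP; split => // y [? []].
have DE : D = disc x r `|` F by rewrite /F setDUK.
have pD z : potential D z = potential (disc x r) z + potential F z.
  by rewrite [in LHS]DE potential_setU.
have aF : area F <= area D by apply: le_area => //; [exact: bF.1|exact: subDsetl].
have far : 4 * potential F x - 2 * h ^+ 4 / r ^+ 4 * area F <= four_sum (potential F) x h.
  apply: potential_four_sum_far => // y [_ nB]; rewrite leNgt psub_enormC; exact/negP.
have center z : enorm (psub z x) = h ->
    potential (disc x r) x + pi / 2 * h ^+ 2 <= potential (disc x r) z.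
  by move=> zx; rewrite -{1}zx; apply: potential_disc_center_ge; rewrite zx; lra.
have near1 (t : R) : `|t| = h -> enorm (psub (x.1 + t, x.2) x) = h.
  by rewrite /enorm /psub/= subrr expr0n addr0 addrAC subrr add0r sqrtr_sqr.
have near2 (t : R) : `|t| = h -> enorm (psub (x.1, x.2 + t) x) = h.
  by rewrite /enorm /psub/= subrr expr0n add0r addrAC subrr add0r sqrtr_sqr.
have hh : `|h| = h by rewrite gtr0_norm.
have hN : `|- h| = h by rewrite normrN.
have c1 := center _ (near1 _ hh); have c2 := center _ (near1 _ hN).
have c3 := center _ (near2 _ hh); have c4 := center _ (near2 _ hN).
have k : 2 * h ^+ 4 / r ^+ 4 * area F <= 2 * h ^+ 4 / r ^+ 4 * area D.
  apply: ler_wpM2l => //; apply: divr_ge0; last by rewrite exprn_ge0// ltW.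
  by rewrite mulr_ge0// exprn_ge0// ltW.
move: far; rewrite /four_sum !pD.
move: (2 * h ^+ 4 / r ^+ 4 * area F) (2 * h ^+ 4 / r ^+ 4 * area D) k => k1 k2 k far.
have -> : 2 * pi * h ^+ 2 = 4 * (pi / 2 * h ^+ 2) by field.
exact: (lin _ _ _ _ _ _ _ _ _ _ _ _ _ c1 c2 c3 c4 far k).
Qed.

(** 2 pi times psi - |x|^2 / 4, the function that is constant on the boundary of a V-state with
    angular velocity 1/2. *)
Definition excess D x : R := potential D x - pi / 2 * enorm x ^+ 2.

Lemma enorm_four_sum x (h : R) :
  four_sum (fun z => enorm z ^+ 2) x h = 4 * enorm x ^+ 2 + 4 * h ^+ 2.
Proof. by rewrite /four_sum !sqr_enorm/=; ring. Qed.

Lemma continuous_potential D : bounded_measurable D -> continuous (potential D).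
Proof.
move=> bD; apply: (@edist_lipschitz_continuous _ _ (2 * (4 * pi + area D))).
  by rewrite mulr_ge0// addr_ge0 ?area_ge0// mulr_ge0// pi_ge0.
by move=> x y; exact: potential_lipschitz.
Qed.

(** The four-point sum of [excess D] is at least its central value times 4, up to an error C h^4.
    Adding e |x|^2 contributes 4 e h^2, which beats this error for small h and so excludes an
    interior maximum. *)
Lemma excess_max_principle D (c : R) : open D -> bounded_measurable D ->
  (forall x, bdry D x -> excess D x = c) -> forall x, D x -> excess D x <= c.
Proof.
move=> oD bD bc x Dx; rewrite leNgt; apply/negP => cx.
have [M M0 DM] := bD.2.
have DM' y : D y -> enorm y <= M by move=> /DM/enorm_disc0/ltW.
have cDM y : closure D y -> enorm y <= M.
  move=> cy; apply/ler_addgt0Pr => e e0; have [z Dz zy] := (closure_disc D y).1 cy _ e0.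
  by have := ler_enorm_edist y z; have := DM' _ Dz; lra.
(* Small enough that e M^2 < excess D x - c: the perturbed function [w] then stays below [w x] on
   the boundary, so its maximum over the closure is attained in [D]. *)
pose e := (excess D x - c) / (M ^+ 2 + 1).
have M2 : 0 < M ^+ 2 + 1 by rewrite ltr_wpDl ?sqr_ge0.
have e0 : 0 < e by rewrite divr_gt0// subr_gt0.
have eE : e * (M ^+ 2 + 1) = excess D x - c by rewrite /e divfK// gt_eqF.
pose w y := excess D y + e * enorm y ^+ 2.
have cw : continuous w.
  move=> y; apply: cvgD.
    apply: cvgB; first exact: continuous_potential.
    apply: cvgM; first exact: cvg_cst.
    by rewrite expr2; under eq_fun do rewrite expr2; apply: cvgM; exact: continuous_enorm.
  apply: cvgM; first exact: cvg_cst.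
  by rewrite expr2; under eq_fun do rewrite expr2; apply: cvgM; exact: continuous_enorm.
have [|||x0 /set_mem cx0 maxw] := @compact_EVT_max _ _ w (closure D).
- by exists x; exact: subset_closure.
- exact: compact_closure2 DM'.
- exact: continuous_subspaceT.
have wx : w x <= w x0 by apply: maxw; rewrite inE; exact: subset_closure.
have Dx0 : D x0.
  apply: contrapT => nD; have bx0 : bdry D x0 by split.
  move: wx; rewrite /w (bc _ bx0).
  have : enorm x0 ^+ 2 <= M ^+ 2 by rewrite lerXn2r// ?nnegrE ?enorm_ge0 ?(ltW M0)// cDM.
  move=> /(ler_wpM2l (ltW e0)).
  have : 0 <= e * enorm x ^+ 2 by rewrite mulr_ge0 ?sqr_ge0// ltW.
  move: eE; rewrite mulrDr mulr1; lra.
have [r r0 rD] := open_disc_sub oD Dx0.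
pose C := 2 / r ^+ 4 * area D.
have C0 : 0 <= C by rewrite mulr_ge0 ?area_ge0// divr_ge0// exprn_ge0// ltW.
have key h : 0 < h -> h < r / 2 -> 4 * e * h ^+ 2 <= C * h ^+ 4.
  move=> h0 hr.
  have := potential_four_sum_ge bD rD h0 (ltW hr).
  have : four_sum w x0 h <= 4 * w x0.
    have near (z : P) : enorm (psub z x0) = h -> w z <= w x0.
      move=> zx; apply: maxw; rewrite inE; apply: subset_closure; apply: rD.
      by rewrite /disc/= zx; lra.
    have near1 (t : R) : `|t| = h -> w (x0.1 + t, x0.2) <= w x0.
      move=> th; apply: near.
      by rewrite /enorm /psub/= subrr expr0n addr0 addrAC subrr add0r sqrtr_sqr.
    have near2 (t : R) : `|t| = h -> w (x0.1, x0.2 + t) <= w x0.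
      move=> th; apply: near.
      by rewrite /enorm /psub/= subrr expr0n add0r addrAC subrr add0r sqrtr_sqr.
    have hh : `|h| = h by rewrite gtr0_norm.
    have hN : `|- h| = h by rewrite normrN.
    have := near1 _ hh; have := near1 _ hN; have := near2 _ hh; have := near2 _ hN.
    rewrite /four_sum; lra.
  have -> : four_sum w x0 h = four_sum (potential D) x0 h
      + (e - pi / 2) * four_sum (fun z => enorm z ^+ 2) x0 h.
    rewrite -four_sum_linear; congr four_sum; apply/funext => z.
    by rewrite /w /excess mulrBl addrA addrAC.
  rewrite enorm_four_sum /w /excess.
  have -> : 2 * h ^+ 4 / r ^+ 4 * area D = C * h ^+ 4 by rewrite /C; ring.
  have -> : 2 * pi * h ^+ 2 = 4 * (pi / 2) * h ^+ 2 by field.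
  move: (four_sum _ _ _) (C * h ^+ 4) (potential D x0) (enorm x0 ^+ 2) (h ^+ 2) (pi / 2).
  by move=> s k v n t p; rewrite mulrBl !mulrDr; lra.
pose h := Num.min (r / 4) (Num.min 1 (e / (C + 1))).
have C1 : 0 < C + 1 by rewrite ltr_wpDl.
have h0 : 0 < h by rewrite !lt_min; apply/and3P; split; [exact: divr_gt0|exact: ltr01|exact: divr_gt0].
have hr : h < r / 2 by rewrite gt_min; apply/orP; left; lra.
have h1 : h <= 1 by rewrite !ge_min lexx orbT.
have hC : C * h <= e.
  have : h <= e / (C + 1) by rewrite !ge_min lexx !orbT.
  rewrite ler_pdivlMr// mulrC mulrDl; have := h0; lra.
have := key h h0 hr; apply/negP; rewrite -ltNge.
have -> : C * h ^+ 4 = (C * h) * h * h ^+ 2 by ring.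
rewrite ltr_pM2r ?exprn_gt0//.
apply: (@le_lt_trans _ _ (e * 1)); last by lra.
by apply: ler_pM => //; [rewrite mulr_ge0// ltW|exact: ltW].
Qed.
End MaximumPrinciple.

(** * The boundary as a graph: the normal at a farthest point, exterior discs *)

Section BoundaryGraph.
Variable R : realType.
Local Notation P := (R * R)%type.
Implicit Types (x y z p : P) (th u v : R).

Definition of_rot th u v : P := (cos th * u - sin th * v, sin th * u + cos th * v).

Lemma rot_u_of_rot th u v : rot_u th (of_rot th u v) = u.
Proof.
rewrite /rot_u /=; have := cos2Dsin2 th; move: (cos th) (sin th) => c s cs.
by transitivity ((c ^+ 2 + s ^+ 2) * u); [ring|rewrite cs mul1r].
Qed.

Lemma rot_v_of_rot th u v : rot_v th (of_rot th u v) = v.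
Proof.
rewrite /rot_v /=; have := cos2Dsin2 th; move: (cos th) (sin th) => c s cs.
by transitivity ((c ^+ 2 + s ^+ 2) * v); [ring|rewrite cs mul1r].
Qed.

Lemma sqr_enorm_rot th z : enorm z ^+ 2 = rot_u th z ^+ 2 + rot_v th z ^+ 2.
Proof.
rewrite sqr_enorm /rot_u /rot_v; have := cos2Dsin2 th.
move: (cos th) (sin th) z.1 z.2 => c s a b cs.
transitivity ((c ^+ 2 + s ^+ 2) * (a ^+ 2 + b ^+ 2)); last ring.
by rewrite cs mul1r.
Qed.

Lemma sqr_enorm_of_rot th u v : enorm (of_rot th u v) ^+ 2 = u ^+ 2 + v ^+ 2.
Proof. by rewrite (sqr_enorm_rot th) rot_u_of_rot rot_v_of_rot. Qed.

Lemma ler_enorm_of_rot th u v : enorm (of_rot th u v) <= `|u| + `|v|.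
Proof.
have -> : enorm (of_rot th u v) = enorm (u, v).
  by apply: eq_enorm; rewrite -!sqr_enorm sqr_enorm_of_rot sqr_enorm.
exact: ler_enorm_l1.
Qed.

Lemma ler_rot_u_enorm th z : `|rot_u th z| <= enorm z.
Proof.
rewrite -(ler_pXn2r (n := 2))// ?nnegrE ?enorm_ge0//.
by rewrite (sqr_enorm_rot th) real_normK ?num_real// lerDl sqr_ge0.
Qed.

Lemma ler_rot_v_enorm th z : `|rot_v th z| <= enorm z.
Proof.
rewrite -(ler_pXn2r (n := 2))// ?nnegrE ?enorm_ge0//.
by rewrite (sqr_enorm_rot th) real_normK ?num_real// lerDr sqr_ge0.
Qed.

Lemma psub_addl p z : psub (p + z) p = z.
Proof. by rewrite psubE addrAC subrr add0r. Qed.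

Lemma rot_psubB th x y p :
  rot_u th (psub x p) - rot_u th (psub y p) = rot_u th (psub x y) /\
  rot_v th (psub x p) - rot_v th (psub y p) = rot_v th (psub x y).
Proof. by rewrite /rot_u /rot_v /psub/=; split; ring. Qed.

Lemma derivable_continuous_at (g : R -> R) t : derivable g t 1 -> {for t, continuous g}.
Proof. by move=> h; apply: differentiable_continuous; exact/derivable1_diffP. Qed.

(* The strict epigraph does not contain [p] but accumulates there. *)
Lemma graph_at_boundary (D : set P) p (r th : R) (g : R -> R) :
  bdry D p -> 0 < r -> {for 0, continuous g} ->
  (forall x, enorm (psub x p) < r ->
     (D x <-> g (rot_u th (psub x p)) < rot_v th (psub x p))) ->
  g 0 = 0.
Proof.
move=> [cp nDp] r0 cg DE.
have ep : enorm (psub p p) < r by rewrite edist_self.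
have rp : rot_u th (psub p p) = 0 /\ rot_v th (psub p p) = 0.
  by rewrite /rot_u /rot_v /psub/= !subrr; split; ring.
apply/eqP; rewrite eq_le; apply/andP; split; last first.
  rewrite leNgt; apply/negP => g0; apply: nDp; apply/(DE _ ep).
  by rewrite rp.1 rp.2.
rewrite leNgt; apply/negP => g0.
have e0 : 0 < g 0 / 2 by rewrite divr_gt0.
move/cvgrPdist_lt : cg => /(_ _ e0) /nbhs_ballP[d /= d0 dg].
pose m := Num.min r (Num.min d (g 0 / 2)).
have m0 : 0 < m by rewrite !lt_min r0 d0 e0.
have [y Dy yp] := (closure_disc D p).1 cp _ m0.
have yr : enorm (psub y p) < r by apply: (lt_le_trans yp); rewrite ge_min lexx.
have yd : enorm (psub y p) < d by apply: (lt_le_trans yp); rewrite !ge_min lexx orbT.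
have yg : enorm (psub y p) < g 0 / 2.
  by apply: (lt_le_trans yp); rewrite !ge_min lexx !orbT.
have := (DE _ yr).1 Dy.
have := ler_rot_u_enorm th (psub y p); have := ler_rot_v_enorm th (psub y p).
move: (rot_u _ _) (rot_v _ _) => u v vy uy guv.
have : ball (0 : R) d u by rewrite /ball/= sub0r normrN (le_lt_trans uy).
move/dg => /=; rewrite ltr_norml => /andP[_ h].
have := ler_norm v; lra.
Qed.

Lemma derive1_first_order (g : R -> R) : derivable g 0 1 -> g 0 = 0 ->
  forall e : R, 0 < e -> exists2 d : R, 0 < d &
    forall s, `|s| < d -> `|g s - g^`()%classic 0 * s| <= e * `|s|.
Proof.
move=> dg g0 e e0.
have E : (fun h : R => h^-1 *: ((g \o shift 0) (h *: (1 : R)) - g 0)) = fun h => h^-1 * g h.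
  by apply/funext => h; rewrite /= addr0 g0 subr0 /GRing.scale/= mulr1.
rewrite derive1E /derive; move: dg; rewrite /derivable E.
move=> /cvgrPdist_lt /(_ _ e0); rewrite near_withinE => /nbhs_ballP[d /= d0 dE].
exists d => // s sd; have [->|s0] := eqVneq s 0.
  by rewrite g0 mulr0 subrr normr0 mulr0.
have := dE s; rewrite /ball/= sub0r normrN => /(_ sd s0).
move=> /= h; set m := lim _ in h *.
have -> : g s - m * s = - s * (m - s^-1 * g s) by field.
by rewrite normrM normrN mulrC ler_wpM2r// ltW.
Qed.

(* If [D] lies in the closed disc about [0] through its boundary point [p], then the
   radius at [p] is normal to the boundary, so it enters [D] inwards. *)
Lemma farthest_point_inward (D : set P) p : bdry D p -> C1_boundary D ->
  0 < enorm p -> (forall x, D x -> enorm x <= enorm p) ->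
  exists2 t0 : R, 0 < t0 & forall t, 0 < t -> t < t0 ->
    D ((1 - t) * p.1, (1 - t) * p.2).
Proof.
move=> bp C1 p0 Dp; have [r [th [g [r0 [dg [_ DE]]]]]] := C1 _ bp.
have g0 : g 0 = 0.
  by apply: (graph_at_boundary bp r0 _ DE); exact: derivable_continuous_at.
have fo := derive1_first_order (dg 0) g0.
set m := g^`()%classic 0 in fo.
pose U := rot_u th p; pose V := rot_v th p.
have UV : enorm p ^+ 2 = U ^+ 2 + V ^+ 2 := sqr_enorm_rot th p.
(* [(U, V)] is p in the local coordinates. A point p + (u, v) of [D] has norm at most |p|, which
   forces 2 (u U + v V) <= - (u^2 + v^2). *)
have half u v : `|u| + `|v| < r -> g u < v -> u * U + v * V <= 0.
  move=> uvr guv; pose x := p + of_rot th u v.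
  have ex : psub x p = of_rot th u v := psub_addl _ _.
  have Dx : D x.
    apply/DE; rewrite ex; first exact: le_lt_trans (ler_enorm_of_rot _ _ _) uvr.
    by rewrite rot_u_of_rot rot_v_of_rot.
  have : enorm x ^+ 2 <= enorm p ^+ 2 by rewrite lerXn2r ?nnegrE ?enorm_ge0// Dp.
  rewrite UV (sqr_enorm_rot th).
  have -> : rot_u th x = U + u.
    by rewrite -[u in RHS](rot_u_of_rot th u v) -ex /U /rot_u /psub/=; ring.
  have -> : rot_v th x = V + v.
    by rewrite -[v in RHS](rot_v_of_rot th u v) -ex /V /rot_v /psub/=; ring.
  have := sqr_ge0 u; have := sqr_ge0 v; nra.
have V0 : V <= 0.
  have r2 : 0 < r / 2 by rewrite divr_gt0.
  have := half 0 (r / 2); rewrite normr0 g0 add0r mul0r add0r gtr0_norm//.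
  have r2r : r / 2 < r by lra.
  by move=> /(_ r2r r2); rewrite pmulr_rle0.
(* Apply [half] to points just above the graph on either side of [0]. *)
have tangent e : 0 < e -> `|U + m * V| <= 2 * e * - V.
  move=> e0; have [d d0 dE] := fo e e0.
  pose k := 1 + `|m| + 2 * e.
  have k0 : 0 < k by rewrite addr_gt0 ?mulr_gt0// ltr_wpDr.
  pose s := Num.min (d / 2) (r / (2 * k)).
  have s0 : 0 < s by rewrite lt_min !divr_gt0// mulr_gt0.
  have sd : s < d by rewrite gt_min; apply/orP; left; lra.
  have sk : s * k < r.
    have : s <= r / (2 * k) by rewrite ge_min lexx orbT.
    rewrite ler_pdivlMr ?mulr_gt0//; lra.
  have side (u : R) : `|u| = s -> u * (U + m * V) <= s * (2 * e * - V).
    move=> us; have := dE u; rewrite us => /(_ sd); rewrite ler_norml => /andP[_ h2].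
    pose v := m * u + 2 * (e * s).
    have es : 0 < e * s by rewrite mulr_gt0.
    have gv : g u < v by rewrite /v; lra.
    have vr : `|u| + `|v| < r.
      apply: le_lt_trans sk; rewrite us.
      have : `|v| <= `|m * u| + `|2 * (e * s)| by exact: ler_normD.
      rewrite normrM us (gtr0_norm (x := 2 * _)) ?mulr_gt0// /k => h.
      by rewrite !mulrDr mulr1; lra.
    have := half u v vr gv; rewrite /v => h.
    have -> : u * (U + m * V) = u * U + (m * u + 2 * (e * s)) * V + s * (2 * e * - V).
      by ring.
    by rewrite gerDr.
  have h1 := side s (gtr0_norm s0).
  have h2 : - s * (U + m * V) <= s * (2 * e * - V).
    by apply: side; rewrite normrN gtr0_norm.
  rewrite ler_pM2l// in h1; rewrite mulNr -mulrN ler_pM2l// in h2.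
  by rewrite ler_norml h1 andbT lerNl.
(* The tangent direction (1, m) is orthogonal to p, so p is [V] times the normal (-m, 1); with
   [V < 0] it points out of the epigraph. The choice of [e] here makes the right side of [tangent]
   smaller than X. *)
have UmV : U + m * V = 0.
  apply/eqP; rewrite -normr_le0 leNgt; apply/negP => X0; set X := `|_| in X0.
  have V1 : 0 < 1 - V by lra.
  have eX : 0 < X / (2 * (1 - V)) by rewrite divr_gt0// mulr_gt0.
  have := tangent _ eX; rewrite -/X.
  have -> : 2 * (X / (2 * (1 - V))) * - V = X * - V / (1 - V) by field; rewrite gt_eqF.
  rewrite ler_pdivlMr// ler_pM2l//; lra.
have Vn : V < 0.
  rewrite lt_neqAle V0 andbT; apply/eqP => V00; move: UmV UV.
  rewrite V00 mulr0 addr0 => ->; rewrite expr0n addr0 => /eqP.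
  by rewrite sqrf_eq0 gt_eqF.
(* At the abscissa -t U the graph has height at most t (m^2 V + e |U|). This is below -t V because V
   < 0 and e |U| < -V. *)
pose e := - V / (`|U| + 1).
have U1 : 0 < `|U| + 1 by rewrite ltr_wpDl.
have e0 : 0 < e by rewrite divr_gt0// oppr_gt0.
have [d d0 dE] := fo e e0.
exists (Num.min (r / enorm p) (d / (`|U| + 1))); first by rewrite lt_min !divr_gt0.
move=> t t0; rewrite lt_min ltr_pdivlMr// ltr_pdivlMr// => /andP[tr td].
set x := (_, _); have ex : psub x p = (- t * p.1, - t * p.2).
  by rewrite /psub/=; congr pair; ring.
have xr : enorm (psub x p) < r by rewrite ex enormZ normrN gtr0_norm.
apply/(DE _ xr); rewrite ex.
have -> : rot_u th (- t * p.1, - t * p.2) = - (t * U) by rewrite /U /rot_u/=; ring.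
have -> : rot_v th (- t * p.1, - t * p.2) = - (t * V) by rewrite /V /rot_v/=; ring.
have tU : `|- (t * U)| = t * `|U| by rewrite normrN normrM gtr0_norm.
have := dE (- (t * U)); rewrite tU => h.
have {h} : `|g (- (t * U)) - m * - (t * U)| <= e * (t * `|U|).
  by apply: h; apply: le_lt_trans td; rewrite ler_pM2l// lerDl.
rewrite ler_norml => /andP[_ h].
have eU : e * `|U| < - V.
  rewrite /e mulrAC ltr_pdivrMr//; nra.
have {eU} h1 : t * (e * `|U|) < t * - V by rewrite ltr_pM2l.
have h2 : m * - (t * U) = t * (m ^+ 2 * V).
  by have -> : U = - (m * V); [lra|ring].
have h3 : t * (m ^+ 2 * V) <= 0 by rewrite pmulr_rle0// mulr_ge0_le0// sqr_ge0.
rewrite h2 in h.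
have h4 : e * (t * `|U|) = t * (e * `|U|) by ring.
have h5 : t * - V = - (t * V) by ring.
lra.
Qed.

(** Outside the closure a disc about [y] itself serves. At a boundary point the centre is moved
    below the graph, where the local description leaves room for a whole disc; thus a missing point
    always comes with missing area. *)
Lemma exterior_disc (D : set P) y (e : R) : ~ D y -> C1_boundary D -> 0 < e ->
  exists q, exists2 r : R, 0 < r & disc q r `<=` disc y e `\` D.
Proof.
move=> nDy C1 e0; have [cy|ncy] := pselect (closure D y); last first.
  have [r r0 rD] : exists2 r : R, 0 < r & forall x, D x -> r <= enorm (psub x y).
    apply: contrapT => h; apply: ncy; apply/closure_disc => r r0.
    apply: contrapT => h'; apply: h; exists r => // x Dx; rewrite leNgt; apply/negP => xr.
    by apply: h'; exists x.
  exists y; exists (Num.min r e); first by rewrite lt_min r0.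
  move=> x; rewrite /disc/= lt_min => /andP[xr xe]; split => // /rD.
  by rewrite leNgt xr.
have by_ : bdry D y by split.
have [r [th [g [r0 [dg [_ DE]]]]]] := C1 _ by_.
have cg := derivable_continuous_at (dg 0).
have g0 : g 0 = 0 := graph_at_boundary by_ r0 cg DE.
pose eta := Num.min (e / 2) (r / 2).
have eta0 : 0 < eta by rewrite lt_min !divr_gt0.
have eta2 : 0 < eta / 2 by rewrite divr_gt0.
move/cvgrPdist_lt : cg => /(_ _ eta2) /nbhs_ballP[d /= d0 dgE].
(* In the disc of radius [k] about the point with local coordinates (0, -eta), the height is below
   -eta / 2 while the graph stays above -eta / 2. *)
pose k := Num.min (eta / 2) d.
have k0 : 0 < k by rewrite lt_min eta2.
have ke : k <= eta / 2 by rewrite ge_min lexx.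
have kd : k <= d by rewrite ge_min lexx orbT.
have ee : eta <= e / 2 by rewrite ge_min lexx.
have er : eta <= r / 2 by rewrite ge_min lexx orbT.
exists (y + of_rot th 0 (- eta)); exists k => // x; rewrite /disc/= => xq.
set q := y + _ in xq.
have qy : enorm (psub q y) <= eta.
  rewrite psub_addl; apply: (le_trans (ler_enorm_of_rot _ _ _)).
  by rewrite normr0 add0r normrN gtr0_norm.
have xy : enorm (psub x y) <= k + eta.
  by apply: (le_trans (edist_triangle x q y)); apply: lerD => //; exact: ltW.
split; first by rewrite /disc/=; lra.
move=> Dx; have xr : enorm (psub x y) < r by lra.
have := (DE _ xr).1 Dx.
have [u1 v1] := rot_psubB th x q y.
have ru : rot_u th (psub q y) = 0 by rewrite psub_addl rot_u_of_rot.
have rv : rot_v th (psub q y) = - eta by rewrite psub_addl rot_v_of_rot.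
have := ler_rot_u_enorm th (psub x q); have := ler_rot_v_enorm th (psub x q).
rewrite -u1 -v1 ru rv subr0 opprK.
move: (rot_u th (psub x y)) (rot_v th (psub x y)) => u v hv hu guv.
have : ball (0 : R) d u by rewrite /ball/= sub0r normrN; apply: le_lt_trans hu _; lra.
move/dgE => /=; rewrite g0 sub0r normrN ltr_norml => /andP[h _].
have := ler_norm (v + eta); lra.
Qed.
End BoundaryGraph.

(** * Comparison of potentials at the farthest point, and rigidity *)

Section RigidityOfTheDisc.
Variable R : realType.
Local Notation P := (R * R)%type.
Local Notation T := (mplane R).
Local Notation mu := (plane_measure R).
Implicit Types (x y p : P) (D E : set P).

(** Since 2 p . (p - y) = |p - y|^2 + |p|^2 - |y|^2, the first-order term in t is at most -t |p -
    y|^2 when |y| <= |p|. *)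
Lemma sqr_edist_homothety p y (t : R) :
  enorm (psub ((1 - t) * p.1, (1 - t) * p.2) y) ^+ 2 =
  (1 - t) * enorm (psub p y) ^+ 2 - t * (enorm p ^+ 2 - enorm y ^+ 2)
    + t ^+ 2 * enorm p ^+ 2.
Proof. by rewrite !sqr_enorm /psub/=; ring. Qed.

(** The last hypothesis bounds the term t^2 |p|^2 by (t / 4) |p - y|^2, so the squared distance
    shrinks at least by the factor 1 - 3 t / 4; halving for the logarithm of the distance gives
    3/8. *)
Lemma log_edist_far_decrease p y (t : R) : 0 < t -> enorm y <= enorm p ->
  0 < enorm (psub p y) -> 0 < enorm (psub ((1 - t) * p.1, (1 - t) * p.2) y) ->
  4 * t * enorm p ^+ 2 <= enorm (psub p y) ^+ 2 ->
  3 / 8 * t <= log_edist p y - log_edist ((1 - t) * p.1, (1 - t) * p.2) y.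
Proof.
move=> t0 yp; have := sqr_edist_homothety p y t.
rewrite /log_edist; set q := (_, _).
move: (enorm (psub p y)) (enorm (psub q y)) => d d' e d0 d'0 h.
have d2 : 0 < d ^+ 2 by rewrite exprn_gt0.
have d'2 : 0 < d' ^+ 2 by rewrite exprn_gt0.
have yp2 : enorm y ^+ 2 <= enorm p ^+ 2 by rewrite lerXn2r// nnegrE enorm_ge0.
have := ln_sub_le d'2 d2; rewrite !lnXn//.
have : (d' ^+ 2 - d ^+ 2) / d ^+ 2 <= - (3 / 4 * t).
  rewrite ler_pdivrMr// e.
  have h1 : 0 <= t * (enorm p ^+ 2 - enorm y ^+ 2) by rewrite mulr_ge0 ?subr_ge0// ltW.
  have h2 : t * (4 * t * enorm p ^+ 2) <= t * d ^+ 2 by rewrite ler_pM2l.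
  lra.
by rewrite !mulr2n; lra.
Qed.

Lemma log_edist_near_decrease p p' y : 0 < enorm (psub p y) -> 0 < enorm (psub p' y) ->
  - enorm (psub p p') * inv_edist p y <= log_edist p y - log_edist p' y.
Proof.
move=> d0 d'0; have := ln_sub_le d'0 d0; rewrite /log_edist /inv_edist.
have : (enorm (psub p' y) - enorm (psub p y)) / enorm (psub p y)
    <= enorm (psub p p') / enorm (psub p y).
  apply: ler_wpM2r; first by rewrite invr_ge0 ltW.
  by have := edist_triangle p' p y; rewrite (psub_enormC p' p); lra.
by rewrite mulNr; lra.
Qed.

(* Moving [p] inwards by [s^2 p] decreases the potential of [E] by at least a multiple
   of [s^2 area E], up to the part of [E] at distance [O(s)] from [p]. *)
Lemma potential_decrease E p (s : R) : bounded_measurable E ->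
  (forall y, E y -> enorm y <= enorm p) -> 0 < enorm p -> 0 < s ->
  3 / 8 * s ^+ 2 * (area E - 4 * pi * enorm p ^+ 2 * s ^+ 2)
    - 10 * pi * enorm p ^+ 2 * s ^+ 3
  <= potential E p - potential E ((1 - s ^+ 2) * p.1, (1 - s ^+ 2) * p.2).
Proof.
move=> bE Ep p0 s0; set t := s ^+ 2; set p' := (_, _); set rho := enorm p in p0 Ep *.
have t0 : 0 < t by rewrite exprn_gt0.
(* The threshold of the far estimate: d^2 = 4 t rho^2. *)
pose d := 2 * rho * s; have d0 : 0 < d by rewrite !mulr_gt0.
have epp' : enorm (psub p p') = t * rho.
  have -> : psub p p' = (t * p.1, t * p.2) by rewrite /psub/=; congr pair; ring.
  by rewrite enormZ gtr0_norm.
pose F := E `\` disc p d; pose G := E `&` disc p d.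
have EFG : E = F `|` G by rewrite setUC /F /G setUIDK.
have FG0 : F `&` G = set0 by apply/seteqP; split => // y [[_ n] [_ /n]].
have bF : bounded_measurable F.
  apply: (bounded_measurableS bE); last exact: subDsetl.
  by apply: measurableD; [exact: bE.1|exact: measurable_disc].
have bG : bounded_measurable G.
  apply: (bounded_measurableS bE); last exact: subIsetl.
  by apply: measurableI; [exact: bE.1|exact: measurable_disc].
have aG : area G <= pi * d ^+ 2.
  rewrite -(area_disc p d0); apply: le_area; last exact: subIsetr.
    exact: bounded_measurable_disc.
  exact: bG.1.
have aE : area E = area F + area G by rewrite [in LHS]EFG area_setU.
have pos z y : z <> y -> 0 < enorm (psub z y).
  by move=> zy; rewrite lt_neqAle enorm_ge0 andbT eq_sym; apply/eqP => /edist0_eq.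
have iL z (H : set P) (bH : bounded_measurable H) := integrable_log_edist z bH.
have lF : 3 / 8 * t * area F <= potential F p - potential F p'.
  rewrite -Rintegral_cst_area// /potential -RintegralB//; [|exact: bF.1|exact: iL|exact: iL].
  apply: (@le_Rintegral_ae2 _ _ p p').
  - exact: bF.1.
  - exact: integrable_cst.
  - by apply: integrableB_EFin; [exact: bF.1|exact: iL|exact: iL].
  - move=> y [Ey nd] py p'y; apply: log_edist_far_decrease => //.
    + exact: Ep.
    + exact: pos.
    + exact: pos.
    + have dy : d <= enorm (psub p y) by rewrite leNgt psub_enormC; exact/negP.
      have -> : 4 * t * enorm p ^+ 2 = d ^+ 2 by rewrite /d /t -/rho; ring.
      by rewrite lerXn2r// ?nnegrE ?enorm_ge0// ltW.
have lG : - (t * rho) * (4 * pi * d + area G / d) <= potential G p - potential G p'.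
  have ii := integrable_inv_edist p bG.
  apply: (@le_trans _ _ (- (t * rho) * \int[mu]_(y in G) inv_edist p y)).
    rewrite !mulNr lerN2; apply: ler_wpM2l; first by rewrite mulr_ge0// ltW.
    exact: Rintegral_inv_edist_le.
  rewrite -RintegralZl//; last exact: bG.1.
  rewrite /potential -RintegralB//; [|exact: bG.1|exact: iL|exact: iL].
  apply: (@le_Rintegral_ae2 _ _ p p').
  - exact: bG.1.
  - by apply: integrableZ_EFin => //; exact: bG.1.
  - by apply: integrableB_EFin; [exact: bG.1|exact: iL|exact: iL].
  - move=> y _ py p'y; rewrite -epp'; apply: log_edist_near_decrease; exact: pos.
have pi0 : 0 < pi :> R := pi_gt0 R.
have pE z : potential E z = potential F z + potential G z.
  by rewrite [in LHS]EFG potential_setU.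
(* [G] lies in a disc of radius d, so area G / d <= pi d, and t rho (5 pi d) = 10 pi rho^2 s^3. *)
have lG' : - (10 * pi * rho ^+ 2 * s ^+ 3) <= - (t * rho) * (4 * pi * d + area G / d).
  have : area G / d <= pi * d by rewrite ler_pdivrMr// -mulrA -expr2.
  move=> h; have : t * rho * (4 * pi * d + area G / d) <= t * rho * (5 * pi * d).
    by apply: ler_wpM2l; [rewrite mulr_ge0// ltW|lra].
  have -> : t * rho * (5 * pi * d) = 10 * pi * rho ^+ 2 * s ^+ 3 by rewrite /t /d; ring.
  by rewrite mulNr lerN2.
have lF' : 3 / 8 * t * (area E - 4 * pi * rho ^+ 2 * t) <= 3 / 8 * t * area F.
  apply: ler_wpM2l; first by rewrite mulr_ge0// ltW.
  have : pi * d ^+ 2 = 4 * pi * rho ^+ 2 * t by rewrite /t /d; ring.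
  lra.
rewrite !pE opprD addrACA; apply: le_trans (lerD lF (le_trans lG' lG)).
by rewrite lerD2r.
Qed.

Lemma area_le_small (A K : R) : 0 <= K ->
  (exists2 s0, 0 < s0 & forall s, 0 < s -> s < s0 -> A <= K * s) -> A <= 0.
Proof.
move=> K0 [s0 s00 h]; apply/ler_addgt0Pr => e e0; rewrite add0r.
pose s := Num.min (s0 / 2) (e / (K + 1)).
have K1 : 0 < K + 1 by rewrite ltr_wpDl.
have sp : 0 < s by rewrite lt_min !divr_gt0.
have ss0 : s < s0 by rewrite gt_min; apply/orP; left; lra.
apply: (le_trans (h _ sp ss0)).
have : s <= e / (K + 1) by rewrite ge_min lexx orbT.
rewrite ler_pdivlMr// mulrC mulrDl mul1r; lra.
Qed.

(** The logarithm is at most t / (1 - t). The coefficient 1 of t must be exact, as it has to cancel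
    against the first-order term coming from [excess]. *)
Lemma ln_inv_onem_le (t : R) : 0 < t -> t <= 1 / 2 -> ln (1 - t)^-1 <= t + 2 * t ^+ 2.
Proof.
move=> t0 t2; have u0 : 0 < 1 - t by lra.
have := ln_sub_le ltr01 u0; rewrite ln1 sub0r -lnV ?posrE//.
have : (1 - (1 - t)) / (1 - t) <= t + 2 * t ^+ 2 by rewrite ler_pdivrMr//; nra.
lra.
Qed.

(* [E] is the part of the disc that [D] misses. Over the segment from [p] to [(1 - t) p]
   the potentials of [D] and of the whole disc decrease by the same first order term, so
   that of [E] changes only by [O(t^2)]. *)
Lemma missing_area0 D p (c : R) : bounded_measurable D -> D `<=` disc 0 (enorm p) ->
  0 < enorm p -> excess D p = c -> (forall x, D x -> excess D x <= c) ->
  (exists2 t0 : R, 0 < t0 & forall t, 0 < t -> t < t0 -> D ((1 - t) * p.1, (1 - t) * p.2)) ->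
  area (disc 0 (enorm p) `\` D) = 0.
Proof.
move=> bD DB p0 ep eD [t0 t00 inD]; set rho := enorm p in p0 DB *.
pose E := disc 0 rho `\` D; rewrite -/E.
have bB := bounded_measurable_disc (0 : P) rho.
have bE : bounded_measurable E.
  by apply: (bounded_measurableS bB); [apply: measurableD; [exact: bB.1|exact: bD.1]|exact: subDsetl].
have pi0 : 0 < pi :> R := pi_gt0 R.
have pB z : potential (disc 0 rho) z = potential D z + potential E z.
  rewrite -potential_setU//; first by rewrite /E setDUK.
  by apply/seteqP; split => // y [? []].
apply/eqP; rewrite eq_le area_ge0 andbT.
(* 8/3 undoes the factor 3/8, and 20 covers the sum 4 t^2 + 10 t s of the remaining terms, because t
   = s^2 <= s. *)
pose K := (8 / 3) * pi * rho ^+ 2 * 20.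
apply: (@area_le_small _ K); first by rewrite !mulr_ge0 ?sqr_ge0// ltW.
exists (Num.min (1 / 2) t0); first by rewrite lt_min t00 andbT; lra.
move=> s sp; rewrite lt_min => /andP[s12 st0].
have t_gt0 : 0 < s ^+ 2 by rewrite exprn_gt0.
have ts : s ^+ 2 <= s by rewrite expr2 ger_pMr//; lra.
set t := s ^+ 2 in t_gt0 ts *; have t12 : t <= 1 / 2 by lra.
have Dp' : D ((1 - t) * p.1, (1 - t) * p.2) by apply: inD => //; lra.
have low := potential_decrease bE (p := p) (s := s).
rewrite -/t in low.
have {}low := low _ p0 sp; rewrite -/rho in low.
set p' := (_, _) in Dp' low.
have ep' : enorm p' = (1 - t) * rho by rewrite enormZ ger0_norm//; lra.
have p'0 : 0 < enorm p' by rewrite ep' mulr_gt0//; lra.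
have p'p : enorm p' < enorm p by rewrite ep' gtr_pMl//; lra.
have up := potential_disc_sub_le p'0 p'p (lexx rho).
have rr : enorm p / enorm p' = (1 - t)^-1.
  by rewrite ep' -/rho invfM mulrCA divff ?mulr1// gt_eqF.
rewrite rr -/rho !pB in up.
have lt := ln_inv_onem_le t_gt0 t12.
have up2 : pi * rho ^+ 2 * ln (1 - t)^-1 <= pi * rho ^+ 2 * (t + 2 * t ^+ 2).
  by apply: ler_wpM2l => //; rewrite mulr_ge0 ?sqr_ge0// ltW.
have := eD _ Dp'; rewrite -ep /excess ep' -/rho => ex.
have exE : pi / 2 * ((1 - t) * rho) ^+ 2 =
  pi / 2 * rho ^+ 2 - pi * rho ^+ 2 * t + pi * rho ^+ 2 * t ^+ 2 / 2 by field.
have W0 : 0 < pi * rho ^+ 2 by rewrite mulr_gt0// exprn_gt0.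
have {}low : 3 / 8 * t * (area E - 4 * pi * rho ^+ 2 * t) - 10 * pi * rho ^+ 2 * s ^+ 3
   <= potential E p - potential E p'.
  by apply: low => y [/enorm_disc0/ltW].
(* 5/2 is 2 from the logarithm plus 1/2 from expanding (1 - t)^2; 3/2 is 3/8 times 4, from the area
   of the disc cut out around p; 10 is the error of the part of [E] near p. *)
have main : 3 / 8 * t * area E <= pi * rho ^+ 2 * (5 / 2 * t ^+ 2 + 3 / 2 * t ^+ 2 + 10 * (t * s)).
  have s3 : 10 * pi * rho ^+ 2 * s ^+ 3 = pi * rho ^+ 2 * (10 * (t * s)) by rewrite /t; ring.
  have l1 : 3 / 8 * t * (area E - 4 * pi * rho ^+ 2 * t) =
     3 / 8 * t * area E - pi * rho ^+ 2 * (3 / 2 * t ^+ 2) by field.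
  rewrite s3 l1 in low; rewrite exE in ex.
  move: (potential D p) (potential D p') (potential E p) (potential E p') low up ex.
  move=> a b c' d low up ex.
  have : 3 / 8 * t * area E <= pi * rho ^+ 2 * (3 / 2 * t ^+ 2) + pi * rho ^+ 2 * (10 * (t * s))
     + (pi * rho ^+ 2 * (t + 2 * t ^+ 2) - pi * rho ^+ 2 * t + pi * rho ^+ 2 * t ^+ 2 / 2).
    lra.
  by move=> h; apply: (le_trans h); rewrite le_eqVlt; apply/orP; left; apply/eqP; field.
have tt : t ^+ 2 <= t * s by rewrite expr2 ler_pM2l.
have ts0 : 0 < t * s by rewrite mulr_gt0.
have : t * (3 / 8 * area E) <= t * (pi * rho ^+ 2 * 20 * s).
  apply: (@le_trans _ _ (3 / 8 * t * area E)); first by rewrite mulrCA mulrA.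
  apply: (le_trans main).
  have -> : t * (pi * rho ^+ 2 * 20 * s) = pi * rho ^+ 2 * (20 * (t * s)) by ring.
  rewrite ler_pM2l//; lra.
by rewrite ler_pM2l// /K; lra.
Qed.

Lemma potential_stream D x : 2 * pi * stream D x = potential D x.
Proof.
rewrite /stream mulrA divff ?mul1r//.
by rewrite mulf_neq0// gt_eqF// pi_gt0.
Qed.
End RigidityOfTheDisc.

Unset Implicit Arguments.

Theorem theorem2 (R : realType) (D : set (R * R)%type) :
  domain2 D -> bounded_set2 D -> simply_connected2 D -> C1_boundary D ->
  barycenter_zero D ->
  (exists mu : R, forall x, bdry D x ->
     stream D x - 4^-1 * enorm x ^+ 2 = mu) ->
  exists c : (R * R)%type, exists r : R, 0 < r /\ D = disc c r.
Proof.
move=> [oD [_ D0]] [M DM] _ C1 _ [nu bnu].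
have bD : bounded_measurable D.
  split; first exact: open_measurable2.
  exists (`|M| + 1); first by rewrite ltr_wpDl.
  by move=> x /DM xM; apply/enorm_disc0; have := ler_norm M; lra.
have bc x : bdry D x -> excess D x = 2 * pi * nu.
  move=> /bnu <-; rewrite mulrBr potential_stream /excess; congr (_ - _).
  by field.
have D1 : closure D !=set0 by case: D0 => x Dx; exists x; exact: subset_closure.
have [p /set_mem cp maxp] := compact_EVT_max D1 (compact_closure2 DM)
  (continuous_subspaceT (@continuous_enorm R)).
have Dp x : D x -> enorm x < enorm p.
  move=> Dx; have [y Dy xy] := open_farther oD Dx; apply: (lt_le_trans xy).
  by apply: maxp; rewrite inE; exact: subset_closure.
have p0 : 0 < enorm p by case: D0 => x /Dp; apply: le_lt_trans; exact: enorm_ge0.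
have bp : bdry D p by split => // /Dp; rewrite ltxx.
have DB : D `<=` disc 0 (enorm p) by move=> x /Dp h; exact/enorm_disc0.
have inward := farthest_point_inward bp C1 p0 (fun x Dx => ltW (Dp x Dx)).
have A0 := missing_area0 bD DB p0 (bc _ bp) (excess_max_principle oD bD bc) inward.
exists 0, (enorm p); split => //; apply/seteqP; split => // y By.
apply: contrapT => nDy.
(* The disc of this radius about [y] stays inside the large disc, so an exterior disc found within
   it would give the null set of missing points positive area. *)
have ye : 0 < enorm p - enorm y by rewrite subr_gt0; exact/enorm_disc0.
have [q [r r0 qE]] := exterior_disc nDy C1 ye.
have : area (disc q r) <= area (disc 0 (enorm p) `\` D).
  have bB := bounded_measurable_disc (0 : (R * R)%type) (enorm p).
  apply: le_area.
  - apply: (bounded_measurableS bB); last exact: subDsetl.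
    by apply: measurableD; [exact: bB.1|exact: bD.1].
  - exact: measurable_disc.
  - move=> x /qE[xy nDx]; split => //; apply/enorm_disc0.
    by have := ler_enorm_edist x y; rewrite psub_enormC; move: xy; rewrite /disc/=; lra.
rewrite A0 area_disc// leNgt mulr_gt0 ?pi_gt0//.
by rewrite exprn_gt0.
Qed.
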